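(* There exists a Borel probability measure $\mu$ on the unit circle $\mathbb{T}=\{z\in\mathbb{C}:|z|=1\}$ such that its Fourier coefficients $\widehat\mu(n)=\int_{\mathbb{T}}z^n\,\mu(dz)$ $(n\in\mathbb{Z})$ satisfy $\widehat\mu(n)\to0$ as $|n|\to\infty$ and the operator $Mf(z)=zf(z)$ acting on $L_2(\mu)$ is weakly supercyclic.
   Context: $L_2(\mu)$ is the complex Hilbert space. A bounded linear operator $T$ on a complex Banach space $\mathcal{B}$ is weakly supercyclic if there exists $x\in\mathcal{B}$ such that the projective orbit $\{\lambda T^nx:n=0,1,2,\dots,\ \lambda\in\mathbb{C}\}$ is dense in $\mathcal{B}$ in the weak topology. *)

(* Defs.v *)
From HB Require Import structures.
From mathcomp Require Import all_boot all_order all_algebra.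
From mathcomp Require Import generic_quotient ring_quotient complex.
From mathcomp Require Import all_classical all_reals all_analysis.
From mathcomp Require Import measurable_realfun.

Set Implicit Arguments.
Unset Strict Implicit.
Unset Printing Implicit Defensive.

Import Order.TTheory GRing.Theory Num.Theory.
Import numFieldNormedType.Exports.
Import Normc.

Local Open Scope classical_set_scope.
Local Open Scope ring_scope.
Local Open Scope complex_scope.
Local Open Scope quotient_scope.

Local Notation Re := complex.Re.
Local Notation Im := complex.Im.

(* The complex package gives R[i] its field, norm and (partial) order, but no
   topology. *)
HB.instance Definition _ (R : realType) := NormedModule.copy R[i] R[i]^o.

Definition borel (T : ptopologicalType) := g_sigma_algebraType (@open T).

Section circle.
Variable R : realType.

Definition circle := {z : R[i] | `|z| == 1}.

HB.instance Definition _ := Choice.on circle.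
(* The subspace topology; the point 1 is only there because measurable types
   have to be pointed. *)
HB.instance Definition _ :=
  Topological.copy circle (initial_topology (@sval _ _ : circle -> R[i])).

Definition circle1 : circle := exist _ 1 (introT eqP (@normr1 R[i])).
HB.instance Definition _ := isPointed.Build circle circle1.

End circle.

Section complex_functions.
Context d (T : measurableType d) (R : realType).

Definition cmeasurable (f : T -> R[i]) :=
  measurable_fun [set: T] (fun x => Re (f x)) /\
  measurable_fun [set: T] (fun x => Im (f x)).

Definition cintegral (mu : {measure set T -> \bar R}) (f : T -> R[i]) : R[i] :=
  Rintegral mu [set: T] (fun x => Re (f x)) +i*
  Rintegral mu [set: T] (fun x => Im (f x)).

Lemma ReD (a b : R[i]) : Re (a + b) = Re a + Re b.
Proof. by case: a b => ? ? []. Qed.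

Lemma ImD (a b : R[i]) : Im (a + b) = Im a + Im b.
Proof. by case: a b => ? ? []. Qed.

Lemma ReM (a b : R[i]) : Re (a * b) = Re a * Re b - Im a * Im b.
Proof. by case: a b => ? ? []. Qed.

Lemma ImM (a b : R[i]) : Im (a * b) = Re a * Im b + Im a * Re b.
Proof. by case: a b => ? ? [] ? ? /=; rewrite addrC [X in _ + X]mulrC. Qed.

Lemma cmeasurable_cst (a : R[i]) : cmeasurable (fun=> a).
Proof. by split; exact: measurable_cst. Qed.

Lemma cmeasurableD f g :
  cmeasurable f -> cmeasurable g -> cmeasurable (fun x => f x + g x).
Proof.
move=> [f1 f2] [g1 g2]; split.
- by under eq_fun do rewrite ReD; exact: measurable_funD.
- by under eq_fun do rewrite ImD; exact: measurable_funD.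
Qed.

Lemma cmeasurableM f g :
  cmeasurable f -> cmeasurable g -> cmeasurable (fun x => f x * g x).
Proof.
move=> [f1 f2] [g1 g2]; split.
- under eq_fun do rewrite ReM.
  by apply: measurable_funB; exact: measurable_funM.
- under eq_fun do rewrite ImM.
  by apply: measurable_funD; exact: measurable_funM.
Qed.

Lemma cmeasurable_normc f : cmeasurable f ->
  measurable_fun [set: T] (fun x => normc (f x)).
Proof.
move=> [f1 f2].
rewrite (_ : (fun _ => _) =
    (fun x => Num.sqrt (Re (f x) ^+ 2 + Im (f x) ^+ 2))); last first.
  by apply/funext => x; case: (f x).
apply: (@measurableT_comp _ _ _ _ _ _ (@Num.sqrt R)).
  by apply: continuous_measurable_fun; exact: sqrt_continuous.
by apply: measurable_funD; exact: measurable_funX.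
Qed.

End complex_functions.

Section L2.
Context d (T : measurableType d) (R : realType).
Variable mu : {measure set T -> \bar R}.

(* 'N[mu]_2[f] is the extended real (\int[mu]_x `|f x| `^ 2) `^ (1 / 2). *)
Definition square_integrable : {pred T -> R[i]} :=
  mem [set f | cmeasurable f /\ finite_norm mu 2 (fun x => normc (f x))].

Lemma square_integrableP f : reflect
  (cmeasurable f /\ finite_norm mu 2 (fun x => normc (f x)))
  (f \in square_integrable).
Proof. by apply: (iffP idP); rewrite inE. Qed.

Lemma ge0_le_Lnorm2 (f g : T -> R) :
  measurable_fun [set: T] f -> measurable_fun [set: T] g ->
  (forall x, 0 <= f x <= g x) ->
  ('N[mu]_2[EFin \o f] <= 'N[mu]_2[EFin \o g])%E.
Proof.
move=> mf mg fg; rewrite unlock /Lnorm.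
apply: gt0_ler_poweR; rewrite ?invr_ge0//.
- by rewrite in_itv/= leey andbT; apply: integral_ge0 => x _; rewrite ?lee_fin ?powR_ge0 ?poweR_ge0.
- by rewrite in_itv/= leey andbT; apply: integral_ge0 => x _; rewrite ?lee_fin ?powR_ge0 ?poweR_ge0.
apply: ge0_le_integral => //=.
- apply/measurable_EFinP; apply/(@measurableT_comp _ _ _ _ _ _ (fun x : R => x `^ 2)) => //.
  exact: measurableT_comp.
- apply/measurable_EFinP; apply/(@measurableT_comp _ _ _ _ _ _ (fun x : R => x `^ 2)) => //.
  exact: measurableT_comp.
- move=> x _; have /andP[f0 fgx] := fg x; rewrite lee_fin.
  by rewrite ge0_ler_powR// ?nnegrE// !ger0_norm// (le_trans f0).
Qed.

Lemma Lnorm_normcD (f g : T -> R[i]) : cmeasurable f -> cmeasurable g ->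
  ('N[mu]_2[EFin \o (fun x => normc (f x + g x))%R] <=
   'N[mu]_2[EFin \o (fun x => normc (f x))%R] +
   'N[mu]_2[EFin \o (fun x => normc (g x))%R])%E.
Proof.
move=> mf mg.
have m1 := cmeasurable_normc mf; have m2 := cmeasurable_normc mg.
have m3 := cmeasurable_normc (cmeasurableD mf mg).
apply: le_trans (eminkowski _ m1 m2 _); last by rewrite lee_fin ler1n.
apply: ge0_le_Lnorm2 => //; first exact: measurable_funD.
move=> x; rewrite le_normcD andbT.
by have := normr_ge0 (f x + g x); rewrite lecE => /andP[].
Qed.

Lemma Lnorm_normcZ (a : R[i]) (f : T -> R[i]) :
  f \in square_integrable ->
  ('N[mu]_2[EFin \o (fun x => normc (a * f x))%R] =
   (normc a)%:E * 'N[mu]_2[EFin \o (fun x => normc (f x))%R])%E.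
Proof.
move=> /square_integrableP[mf fmf].
have p1 : (1 <= 2%:E :> \bar R)%E by rewrite lee_fin ler1n.
have fL : (fun x => normc (f x)) \in Lfun mu 2%:E.
  by rewrite inE; apply/andP; rewrite !inE; split => //=; exact: cmeasurable_normc.
have := LnormZ (Lfun_Sub p1 fL) (normc a).
rewrite ger0_norm; last by have := normr_ge0 a; rewrite lecE => /andP[].
move=> <-; congr Lnorm; apply/funext => x /=; rewrite normcM//.
Qed.

Lemma square_integrable_submod : submod_closed square_integrable.
Proof.
split.
  apply/square_integrableP; split; first exact: cmeasurable_cst.
  rewrite /finite_norm (_ : _ \o _ = cst 0%E); first by rewrite Lnorm0.
  by apply/funext => x; rewrite -[RHS]/((0 : R)%:E) -(normc0 R).
move=> a f g fL gL.
have [mf nf] := square_integrableP _ fL; have [mg ng] := square_integrableP _ gL.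
have maf : cmeasurable (fun x => a * f x).
  by apply: cmeasurableM => //; exact: cmeasurable_cst.
apply/square_integrableP; split; first exact: cmeasurableD.
apply: le_lt_trans (Lnorm_normcD maf mg) _.
rewrite lte_add_pinfty// Lnorm_normcZ// lte_mul_pinfty//.
by have := normr_ge0 a; rewrite lecE => /andP[].
Qed.

HB.instance Definition _ :=
  GRing.isSubmodClosed.Build _ _ square_integrable square_integrable_submod.

Definition L2fun := {f : T -> R[i] | square_integrable f}.

HB.instance Definition _ := SubChoice.on L2fun.
HB.instance Definition _ := [SubChoice_isSubLmodule of L2fun by <:].

Definition ae_zero : {pred L2fun} :=
  mem [set f : L2fun | {ae mu, forall x, val f x = 0}].

Lemma ae_zeroP (f : L2fun) :
  reflect {ae mu, forall x, val f x = 0} (f \in ae_zero).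
Proof. by apply: (iffP idP); rewrite inE. Qed.

Lemma ae_zero_submod : submod_closed ae_zero.
Proof.
split; first by apply/ae_zeroP; exact: nearW.
move=> a f g /ae_zeroP f0 /ae_zeroP g0; apply/ae_zeroP.
apply: filterS2 f0 g0 => x fx gx.
by rewrite /= -[LHS]/(a * val f x + val g x) fx gx mulr0 addr0.
Qed.

HB.instance Definition _ :=
  GRing.isSubmodClosed.Build _ _ ae_zero ae_zero_submod.

(* L_2(mu): square-integrable complex functions modulo equality mu-almost
   everywhere; {quot _} identifies f and g when f - g \in ae_zero. *)
Definition L2 := @Quotient.quot _ ae_zero.

HB.instance Definition _ := GRing.Zmodule.on L2.
HB.instance Definition _ := EqQuotient.on L2.

Lemma L2_eqP (f g : L2fun) :
  \pi_L2 f = \pi_L2 g <-> {ae mu, forall x, val f x = val g x}.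
Proof.
have -> : (\pi_L2 f = \pi_L2 g) <-> (f - g \in ae_zero).
  by rewrite Quotient.idealrBE; split => /eqP.
split => [/ae_zeroP|fg]; last apply/ae_zeroP; last first.
  by apply: filterS fg => x fgx; rewrite -[LHS]/(val f x - val g x) fgx subrr.
by apply: filterS => x fg; apply/eqP; rewrite -subr_eq0; exact/eqP/fg.
Qed.

Lemma L2_reprK (u : L2) : \pi_L2 (repr u) = u.
Proof. exact: reprK. Qed.

Lemma repr_L2 (f : L2fun) :
  {ae mu, forall x, val (repr (\pi_L2 f)) x = val f x}.
Proof. by apply/L2_eqP; rewrite reprK. Qed.

Definition L2scale (a : R[i]) (u : L2) : L2 := \pi_L2 (a *: repr u).

Lemma pi_L2scale (a : R[i]) (f : L2fun) : L2scale a (\pi_L2 f) = \pi_L2 (a *: f).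
Proof.
apply/L2_eqP; apply: filterS (repr_L2 f) => x fx.
by rewrite -[LHS]/(a * val (repr (\pi_L2 f)) x) fx.
Qed.

Lemma pi_L2D (f g : L2fun) : \pi_L2 (f + g) = \pi_L2 f + \pi_L2 g.
Proof. by rewrite piE. Qed.

Lemma L2scaleA a b (u : L2) : L2scale a (L2scale b u) = L2scale (a * b) u.
Proof. by rewrite -[u]L2_reprK !pi_L2scale scalerA. Qed.

Lemma L2scale1 : left_id 1 L2scale.
Proof. by move=> u; rewrite -[u]L2_reprK !pi_L2scale scale1r. Qed.

Lemma L2scaleDr : right_distributive L2scale +%R.
Proof.
move=> a u v; rewrite -[u]L2_reprK -[v]L2_reprK -pi_L2D !pi_L2scale -pi_L2D.
by rewrite scalerDr.
Qed.

Lemma L2scaleDl u : {morph L2scale^~ u : a b / a + b}.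
Proof.
by move=> a b; rewrite /= -[u]L2_reprK !pi_L2scale -pi_L2D scalerDl.
Qed.

HB.instance Definition _ := GRing.Zmodule_isLmodule.Build R[i] L2
  L2scaleA L2scale1 L2scaleDr L2scaleDl.

Definition L2norm (u : L2) : R :=
  fine ('N[mu]_2[EFin \o (fun x => normc (val (repr u) x))%R])%E.

Lemma L2funP (f : L2fun) : cmeasurable (val f) /\
  finite_norm mu 2 (fun x => normc (val f x)).
Proof. by apply/square_integrableP; exact: (valP f). Qed.

Lemma L2normE (f : L2fun) :
  (L2norm (\pi_L2 f))%:E =
  ('N[mu]_2[EFin \o (fun x => normc (val f x))%R])%E.
Proof.
have [mr nr] := L2funP (repr (\pi_L2 f)).
rewrite /L2norm fineK; last by rewrite ge0_fin_numE// Lnorm_ge0.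
rewrite unlock /Lnorm; congr poweR.
have [mf _] := L2funP f.
have mN (h : T -> R[i]) : cmeasurable h ->
    measurable_fun [set: T] (fun x => (`|normc (h x)| `^ 2)%:E).
  move=> /cmeasurable_normc mh; apply/measurable_EFinP.
  apply/(@measurableT_comp _ _ _ _ _ _ (fun x : R => x `^ 2)) => //.
  exact: measurableT_comp.
apply: ae_eq_integral => //; [exact: mN|exact: mN|].
by apply: filterS (repr_L2 f) => x /= ->.
Qed.

Lemma ler_L2normD u v : L2norm (u + v) <= L2norm u + L2norm v.
Proof.
rewrite -lee_fin EFinD -[u]L2_reprK -[v]L2_reprK -pi_L2D !L2normE.
by apply: Lnorm_normcD; [have [] := L2funP (repr u)|have [] := L2funP (repr v)].
Qed.

Lemma L2normZ (a : R[i]) u : L2norm (a *: u) = normc a * L2norm u.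
Proof.
apply/EFin_inj; rewrite EFinM -[u]L2_reprK.
rewrite -[_ *: _]/(L2scale a _) pi_L2scale !L2normE.
exact: (Lnorm_normcZ a (valP (repr u))).
Qed.

Lemma L2norm_eq0 u : L2norm u = 0 -> u = 0.
Proof.
move=> /(congr1 (@EFin R)); rewrite -[u]L2_reprK L2normE => u0.
have [mf _] := L2funP (repr u).
have mn : measurable_fun [set: T] (EFin \o (fun x => normc (val (repr u) x))).
  by apply/measurable_EFinP; exact: cmeasurable_normc.
have p0 : (0 < 2%:E :> \bar R)%E by rewrite lte_fin.
have -> : 0 = \pi_L2 0 by rewrite piE.
apply/L2_eqP; apply: filterS (Lnorm_eq0_eq0 mn p0 u0) => x.
move=> /(_ I) [nx0]; exact: eq0_normc nx0.
Qed.

Let ler_L2normDC u v :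
  (L2norm (u + v))%:C <= (L2norm u)%:C + (L2norm v)%:C.
Proof. by rewrite -rmorphD/= lecR ler_L2normD. Qed.

Let L2normZC (a : R[i]) u : (L2norm (a *: u))%:C = `|a| * (L2norm u)%:C.
Proof. by rewrite L2normZ rmorphM. Qed.

Let L2norm_eq0C u : (L2norm u)%:C = 0 -> u = 0.
Proof. by move/complexI/L2norm_eq0. Qed.

(* The norm of a normed module over R[i] takes its values in R[i]. *)
HB.instance Definition _ := @Lmodule_isNormed.Build R[i] L2
  (fun u => (L2norm u)%:C) ler_L2normDC L2normZC L2norm_eq0C.

End L2.

Section weak_supercyclicity.
Context (R : realType) (B : normedModType R[i]).

Definition dual := {phi : {linear B -> R[i]} | continuous phi}.

HB.instance Definition _ := gen_eqMixin dual.
HB.instance Definition _ := gen_choiceMixin dual.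

(* {ptws _ -> _} is the product topology, so that weak is the coarsest topology
   on B making every continuous linear functional continuous. *)
Definition weak_eval (x : B) : {ptws dual -> R[i]} := fun phi => sval phi x.

Definition weak := initial_topology weak_eval.

HB.instance Definition _ := Topological.on weak.

Definition projective_orbit (T : {linear B -> B}) (x : B) : set B :=
  [set y | exists (lambda : R[i]) (n : nat), y = lambda *: iter n T x].

(* Between normed spaces, a linear map is bounded iff it is continuous.  The
   completeness of B plays no part in the definition. *)
Definition weakly_supercyclic (T : {linear B -> B}) :=
  continuous T /\ exists x : B, dense (projective_orbit T x : set weak).

End weak_supercyclicity.

Section circle_measure.
Variable R : realType.

Lemma normc_ge_Im (z : R[i]) : `|Im z|%:C <= `|z|.
Proof. by rewrite normc_def lecR -sqrtr_sqr ler_wsqrtr// lerDr sqr_ge0. Qed.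

Lemma Re_continuous : continuous (fun z : R[i] => Re z).
Proof.
move=> z; apply/(@cvgrPdist_lt _ _ _ (nbhs z)) => e e0.
have e0C : 0 < e%:C by rewrite ltcR.
have := nbhsx_ballx (z : R[i]^o) e%:C e0C; apply: filterS => w.
rewrite -ball_normE /= => zwe; rewrite -ltcR; apply: le_lt_trans zwe.
by have := normc_ge_Re (z - w); rewrite ReD; case: (w).
Qed.

Lemma Im_continuous : continuous (fun z : R[i] => Im z).
Proof.
move=> z; apply/(@cvgrPdist_lt _ _ _ (nbhs z)) => e e0.
have e0C : 0 < e%:C by rewrite ltcR.
have := nbhsx_ballx (z : R[i]^o) e%:C e0C; apply: filterS => w.
rewrite -ball_normE /= => zwe; rewrite -ltcR; apply: le_lt_trans zwe.
by have := normc_ge_Im (z - w); rewrite ImD; case: (w).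
Qed.

Lemma circle_val_continuous : continuous (fun z : circle R => sval z).
Proof. exact: initial_continuous. Qed.

Lemma continuous_borel_measurable (X : ptopologicalType) (f : X -> R) :
  continuous f -> measurable_fun [set: borel X] f.
Proof.
move=> /continuousP cf; apply: (measurability _ (RGenOInfty.measurableE R)).
move=> _ [_ [a ->] <-]; rewrite setTI.
by apply: sub_sigma_algebra; apply: cf; exact: interval_open.
Qed.

Lemma circle_cmeasurable : cmeasurable (fun z : borel (circle R) => sval z).
Proof.
split; apply: continuous_borel_measurable => z.
- by apply: continuous_comp; [exact: circle_val_continuous|exact: Re_continuous].
- by apply: continuous_comp; [exact: circle_val_continuous|exact: Im_continuous].
Qed.

Lemma normc_circle (z : circle R) : normc (sval z) = 1.
Proof. by apply: complexI; exact/eqP/(svalP z). Qed.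

Variable mu : probability (borel (circle R)) R.

Definition fourier (n : int) : R[i] := cintegral mu (fun z => sval z ^ n).

Lemma mulz_square_integrable (f : L2fun mu) :
  (fun z => sval z * val f z) \in square_integrable mu.
Proof.
have [mf nf] := L2funP f; apply/square_integrableP; split.
  by apply: cmeasurableM => //; exact: circle_cmeasurable.
rewrite /finite_norm (_ : (fun _ => _) = (fun z => normc (val f z)))//.
by apply/funext => z; rewrite normcM normc_circle mul1r.
Qed.

Definition mulz_fun (f : L2fun mu) : L2fun mu :=
  Sub (fun z => sval z * val f z) (mulz_square_integrable f).

Definition mulz (u : L2 mu) : L2 mu := \pi_(L2 mu) (mulz_fun (repr u)).

(* Does not depend on the representative chosen in mulz. *)
Lemma mulzE (f : L2fun mu) : mulz (\pi_(L2 mu) f) = \pi_(L2 mu) (mulz_fun f).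
Proof.
apply/L2_eqP; apply: filterS (repr_L2 f) => z fz.
by rewrite /= -[LHS]/(_ * val _ z) fz.
Qed.

Lemma mulz_linear : linear mulz.
Proof.
move=> a u v; rewrite -[u]L2_reprK -[v]L2_reprK.
rewrite -[a *: _]/(L2scale a _) pi_L2scale -pi_L2D !mulzE.
rewrite -[a *: _]/(L2scale a _) pi_L2scale -pi_L2D; apply/L2_eqP.
apply: nearW => z.
rewrite -[LHS]/(sval z * (a * val (repr u) z + val (repr v) z)).
rewrite -[RHS]/(a * (sval z * val (repr u) z) + sval z * val (repr v) z).
by rewrite mulrDr mulrCA.
Qed.

HB.instance Definition _ :=
  GRing.isLinear.Build R[i] (L2 mu) (L2 mu) _ mulz mulz_linear.

Lemma norm_mulz (u : L2 mu) : `|mulz u| = `|u|.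
Proof.
congr (_%:C); apply/EFin_inj; rewrite -[u]L2_reprK mulzE !L2normE.
congr Lnorm; apply/funext => z /=; congr EFin.
by rewrite normcM normc_circle mul1r.
Qed.

Lemma mulz_continuous : continuous mulz.
Proof.
apply: bounded_linear_continuous; apply/linear_boundedP.
exists 1; split; first exact: real1.
by move=> y y1 u; rewrite norm_mulz ler_peMl// ltW.
Qed.

End circle_measure.

Arguments fourier {R} mu n.
Arguments mulz {R} mu u.

(* Main.v *)
From HB Require Import structures.
Require Import Defs.
From mathcomp Require Import all_boot all_order all_algebra.
From mathcomp Require Import complex.
From mathcomp Require Import all_classical all_reals all_analysis.
From mathcomp Require Import measurable_realfun zify ring lra.

(** Let M be multiplication by the coordinate z, so that M^n maps the constant
    function 1 to z^n.  The measure mu is built so that 1 is a weakly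
    supercyclic vector although the Fourier coefficients of mu vanish at
    infinity.

    The mechanism.  Suppose that f is a trigonometric polynomial, and that for a
    block of L indices k one has z^(n_k) = c f + u_k with the same c > 0 and with
    u_k pairwise orthogonal and bounded in L_2(mu).  A bounded functional phi
    cannot see many orthogonal vectors: the sum of |phi u_k|^2 over the block is
    at most a constant that does not depend on L ([bessel]).  This remains true
    when the sum also runs over finitely many functionals, so some k in the block
    satisfies |phi u_k| <= const / sqrt L for all of them at once, and
    phi (c^-1 z^(n_k)) differs from phi f by at most const / (c sqrt L).  Hence f
    is in the weak closure of the projective orbit as soon as c^2 L is unbounded
    along the blocks that serve f, and c is allowed to tend to 0 provided that
    the blocks are long enough ([exists_small_innovation]).

    The measure.  Identities z^(n_k) = c_k f_k + u_k of this kind hold for the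
    Riesz product  prod_k (1 + 2 c_k Re (z^(-n_k) f_k))  when n_k grows fast: the
    spectra added by the successive factors are disjoint, so every Fourier
    coefficient is eventually constant, and reading off the coefficients near
    n_k gives, with no error term, that z^(n_k) - c_k f_k is orthogonal to all
    trigonometric polynomials of low degree ([riesz_coef_freq],
    [innovation_orth]).  The coefficients added by the k-th factor are bounded by
    c_k, so they vanish at infinity when c_k does ([riesz_coef_decay]).  Since
    only the coefficients matter, everything about the product is algebra on
    lists of coefficients; the measure itself is the Lebesgue-Stieltjes measure
    of the uniform limit of the distribution functions of the partial products,
    transported to the circle ([limit_measure_exists]).

    The conclusion.  The polynomials f_k run through the trigonometric
    polynomials with rational coefficients and l1-norm at most 1, each one being
    served by infinitely many blocks.  Up to scalars these are dense among all
    trigonometric polynomials ([rational_approx]), which are dense in L_2(mu)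
    ([trigL2_dense]); and weak density only tests finitely many functionals at a
    time ([weak_denseP]). *)

Set Implicit Arguments.
Unset Strict Implicit.
Unset Printing Implicit Defensive.

Import Order.TTheory GRing.Theory Num.Theory.
Import numFieldNormedType.Exports.
Import Normc.

Local Open Scope classical_set_scope.
Local Open Scope ring_scope.

Local Notation Re := complex.Re.
Local Notation Im := complex.Im.

(** * Trigonometric polynomials as lists of coefficients *)

Section trigpoly.
Variable C : numClosedFieldType.
Implicit Types (p q : seq (C * int)) (z a : C) (m : int).

(** A pair (a, m) of the list stands for the monomial a z^m; exponents may be
    repeated, which makes sums and products plain list operations. *)
Definition ev p z : C := \sum_(x <- p) x.1 * z ^ x.2.
Definition tscale a p := [seq (a * x.1, x.2) | x <- p].
Definition tmul p q := [seq (x.1 * y.1, x.2 + y.2) | x <- p, y <- q].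
Definition tconj p := [seq (x.1^*, - x.2) | x <- p].
Definition l1norm p : C := \sum_(x <- p) `|x.1|.
Definition tdeg p : nat := \max_(x <- p) `|x.2|%N.
(** The integral of z^m against the density [ev p] on the circle, that is the
    coefficient of z^(-m); this sign matches [fourier]. *)
Definition hat p m : C := \sum_(x <- p | x.2 == - m) x.1.
(** The integral of [ev p] against a measure with Fourier coefficients [nu]. *)
Definition pairing (nu : int -> C) p : C := \sum_(x <- p) x.1 * nu x.2.

Lemma ev_seq1 a m z : ev [:: (a, m)] z = a * z ^ m.
Proof. by rewrite /ev big_seq1. Qed.

Lemma ev_cat p q z : ev (p ++ q) z = ev p z + ev q z.
Proof. by rewrite /ev big_cat. Qed.

Lemma ev_scale a p z : ev (tscale a p) z = a * ev p z.
Proof. by rewrite /ev big_map mulr_sumr; apply: eq_bigr => x _; rewrite mulrA. Qed.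

Lemma ev_mul p q z : z != 0 -> ev (tmul p q) z = ev p z * ev q z.
Proof.
move=> z0; rewrite /ev big_allpairs_dep/= mulr_suml; apply: eq_bigr => x _.
by rewrite mulr_sumr; apply: eq_bigr => y _ /=; rewrite expfzDr// mulrACA.
Qed.

Lemma norm1_neq0 z : `|z| = 1 -> z != 0.
Proof. by move=> z1; rewrite -normr_gt0 z1 ltr01. Qed.

Lemma norm1_expz z m : `|z| = 1 -> `|z ^ m| = 1.
Proof.
by case: m => n z1; rewrite ?NegzE -?exprnN -?exprnP ?normfV normrX z1 expr1n ?invr1.
Qed.

Lemma norm1_conj z : `|z| = 1 -> z^* = z^-1.
Proof. by move=> z1; rewrite invC_norm z1 expr1n invr1 mul1r. Qed.

Lemma ev_conj p z : `|z| = 1 -> ev (tconj p) z = (ev p z)^*.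
Proof.
move=> z1; rewrite /ev big_map rmorph_sum; apply: eq_bigr => x _ /=.
by rewrite rmorphM/= (norm1_conj (norm1_expz x.2 z1)) invr_expz.
Qed.

Lemma le_ev_l1 p z : `|z| = 1 -> `|ev p z| <= l1norm p.
Proof.
move=> z1; apply: le_trans (ler_norm_sum _ _ _) _; apply: ler_sum => x _.
by rewrite normrM norm1_expz// mulr1.
Qed.

Lemma l1_ge0 p : 0 <= l1norm p.
Proof. exact: sumr_ge0. Qed.

Lemma l1_cat p q : l1norm (p ++ q) = l1norm p + l1norm q.
Proof. by rewrite /l1norm big_cat. Qed.

Lemma l1_scale a p : l1norm (tscale a p) = `|a| * l1norm p.
Proof. by rewrite /l1norm big_map mulr_sumr; apply: eq_bigr => x _; rewrite normrM. Qed.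

Lemma l1_conj p : l1norm (tconj p) = l1norm p.
Proof. by rewrite /l1norm big_map; apply: eq_bigr => x _; rewrite norm_conjC. Qed.

Lemma l1_mul p q : l1norm (tmul p q) = l1norm p * l1norm q.
Proof.
rewrite /l1norm big_allpairs_dep/= mulr_suml; apply: eq_bigr => x _.
by rewrite mulr_sumr; apply: eq_bigr => y _ /=; rewrite normrM.
Qed.

Lemma le_tdeg p x : x \in p -> (`|x.2| <= tdeg p)%N.
Proof. by move=> xp; rewrite /tdeg; apply: leq_bigmax_seq. Qed.

Lemma hat_cat p q m : hat (p ++ q) m = hat p m + hat q m.
Proof. by rewrite /hat big_cat. Qed.

Lemma hat_scale a p m : hat (tscale a p) m = a * hat p m.
Proof. by rewrite /hat big_map mulr_sumr. Qed.

(** Fourier coefficients of a product are a finite convolution; this is the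
    only computation behind the Riesz product. *)
Lemma hat_mul p q m :
  hat (tmul p q) m = \sum_(x <- p) x.1 * hat q (m + x.2).
Proof.
rewrite /hat /tmul big_mkcond big_allpairs_dep/=; apply: eq_bigr => x _.
rewrite mulr_sumr [RHS]big_mkcond; apply: eq_bigr => y _ /=.
by rewrite (_ : (x.2 + y.2 == - m) = (y.2 == - (m + x.2)))//; apply/eqP/eqP; lia.
Qed.

Lemma hat_shift a m q n : hat (tmul [:: (a, n)] q) m = a * hat q (m + n).
Proof. by rewrite hat_mul big_seq1. Qed.

Lemma hat_conj_mul p q m :
  hat (tmul (tconj p) q) m = \sum_(x <- p) x.1^* * hat q (m - x.2).
Proof. by rewrite hat_mul big_map. Qed.

(** The inner product of [ev p] and [ev q] in L_2 of a measure with Fourier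
    coefficients [nu]. *)
Definition sesq nu p q : C := pairing nu (tmul p (tconj q)).

Lemma sesqE nu p q : sesq nu p q =
  \sum_(x <- p) \sum_(y <- q) x.1 * y.1^* * nu (x.2 - y.2).
Proof.
by rewrite /sesq /pairing big_allpairs_dep/=; apply: eq_bigr => x _; rewrite big_map.
Qed.

Lemma sesq_catl nu p1 p2 q : sesq nu (p1 ++ p2) q = sesq nu p1 q + sesq nu p2 q.
Proof. by rewrite !sesqE big_cat. Qed.

Lemma sesq_catr nu p q1 q2 : sesq nu p (q1 ++ q2) = sesq nu p q1 + sesq nu p q2.
Proof. by rewrite !sesqE -big_split; apply: eq_bigr => x _; rewrite big_cat. Qed.

Lemma sesq_scalel nu a p q : sesq nu (tscale a p) q = a * sesq nu p q.
Proof.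
rewrite !sesqE big_map mulr_sumr; apply: eq_bigr => x _.
by rewrite mulr_sumr; apply: eq_bigr => y _; rewrite !mulrA.
Qed.

Lemma sesq_scaler nu a p q : sesq nu p (tscale a q) = a^* * sesq nu p q.
Proof.
rewrite !sesqE mulr_sumr; apply: eq_bigr => x _.
rewrite big_map mulr_sumr; apply: eq_bigr => y _ /=.
by rewrite rmorphM/=; ring.
Qed.

Lemma sesq_herm nu p q : (forall m, nu (- m) = (nu m)^*) ->
  sesq nu q p = (sesq nu p q)^*.
Proof.
move=> nuN; rewrite !sesqE exchange_big rmorph_sum; apply: eq_bigr => x _.
rewrite rmorph_sum; apply: eq_bigr => y _ /=.
by rewrite !rmorphM/= conjCK -nuN opprB; ring.
Qed.

(** * Riesz products *)

Section riesz.
Variables (f : nat -> seq (C * int)) (c : nat -> C).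

(** The factor 4 keeps the spectrum added at stage k away from the previous
    one, even after multiplication by [f k]; the summand 4 ^ k.+1 makes the
    distribution functions converge geometrically. *)
Definition freq_after (D k : nat) := (4 * (D + tdeg (f k)) + 4 ^ k.+1)%N.

(** A bound for the frequencies that occur in the k-th partial product. *)
Fixpoint freq_bound k :=
  if k is k'.+1 then (freq_bound k' + freq_after (freq_bound k') k' + tdeg (f k'))%N
  else 0%N.

Definition freq k := freq_after (freq_bound k) k.

(** What multiplication by 1 + 2 c_k Re (z^(-n_k) f_k) adds to [p]. *)
Definition increment p k := tscale (c k)
  (tmul [:: (1, - (freq k)%:Z)] (tmul (f k) p) ++
   tmul [:: (1, (freq k)%:Z)] (tmul (tconj (f k)) p)).

Fixpoint riesz k :=
  if k is k'.+1 then riesz k' ++ increment (riesz k') k' else [:: (1, 0)].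

(** Only the first |m| factors can affect the m-th coefficient, so this is
    the common value of the m-th coefficients of all later partial products
    ([riesz_coef_lim]). *)
Definition riesz_coef m := hat (riesz `|m|) m.

Lemma freq_boundS k :
  freq_bound k.+1 = (freq_bound k + freq k + tdeg (f k))%N.
Proof. by []. Qed.

Lemma rieszS k : riesz k.+1 = riesz k ++ increment (riesz k) k.
Proof. by []. Qed.

Lemma freq_bound_mono j k : (j <= k)%N -> (freq_bound j <= freq_bound k)%N.
Proof.
move=> /subnK <-; elim: (k - j)%N => // i; rewrite addSn freq_boundS; lia.
Qed.

Lemma freq_gt k : (2 * (freq_bound k + tdeg (f k)) < freq k)%N.
Proof. by rewrite /freq /freq_after; have := expn_gt0 4 k.+1; lia. Qed.

Lemma hat_increment p k m : hat (increment p k) m =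
  c k * (\sum_(x <- f k) x.1 * hat p (m - (freq k)%:Z + x.2)) +
  c k * (\sum_(x <- f k) x.1^* * hat p (m + (freq k)%:Z - x.2)).
Proof. by rewrite hat_scale hat_cat !hat_shift hat_mul hat_conj_mul !mul1r mulrDr. Qed.

(** One of the two halves of an increment does not contribute to a
    coefficient whose frequency is out of its reach. *)
Let sum_hat0 (g : C -> C) p (k : nat) (h : int -> int) :
  (forall i, (`|i| <= tdeg (f k))%N -> hat p (h i) = 0) ->
  c k * (\sum_(x <- f k) g x.1 * hat p (h x.2)) = 0.
Proof.
move=> h0; rewrite big_seq big1 ?mulr0// => x /le_tdeg xf.
by rewrite h0// mulr0.
Qed.

Lemma riesz_supp k m : (freq_bound k < `|m|)%N -> hat (riesz k) m = 0.
Proof.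
elim: k m => [|k ih] m.
  by rewrite /hat big_mkcond big_seq1/= => m0; case: eqP => //; lia.
rewrite freq_boundS => Dm; rewrite rieszS hat_cat ih ?add0r; last lia.
rewrite hat_increment (@sum_hat0 id _ _ (fun i => m - (freq k)%:Z + i)).
  rewrite (@sum_hat0 (fun a => a^*) _ _ (fun i => m + (freq k)%:Z - i)) ?addr0//.
  by move=> i id; apply: ih; lia.
by move=> i id; apply: ih; lia.
Qed.

(** The increment has its spectrum within distance
    [freq_bound k + tdeg (f k)] of plus or minus [freq k]. *)
Lemma riesz_stableS k m : (`|m| + tdeg (f k) + freq_bound k < freq k)%N ->
  hat (riesz k.+1) m = hat (riesz k) m.
Proof.
move=> mk; rewrite rieszS hat_cat hat_increment.
rewrite (@sum_hat0 id _ _ (fun i => m - (freq k)%:Z + i)).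
  rewrite (@sum_hat0 (fun a => a^*) _ _ (fun i => m + (freq k)%:Z - i)) ?addr0//.
  by move=> i id; apply: riesz_supp; lia.
by move=> i id; apply: riesz_supp; lia.
Qed.

Lemma riesz_stable k j m : (`|m| + tdeg (f k) + freq_bound k < freq k)%N ->
  (k <= j)%N -> hat (riesz j) m = hat (riesz k) m.
Proof.
move=> mk /subnK <-; elim: (j - k)%N => // i ih; rewrite addSn -{}ih.
case: i => [|i]; first exact: riesz_stableS.
apply: riesz_stableS.
have := freq_gt (i.+1 + k); set j' := (i.+1 + k)%N.
have : (freq_bound k.+1 <= freq_bound j')%N by apply: freq_bound_mono; lia.
rewrite freq_boundS; lia.
Qed.

Lemma riesz_coef_lim j m : (`|m| <= j)%N -> hat (riesz j) m = riesz_coef m.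
Proof.
move=> mj; apply: riesz_stable => //; rewrite /freq /freq_after.
by have := ltn_expl (`|m|.+1) (isT : (1 < 4)%N); lia.
Qed.

Lemma riesz_coefE k m : (`|m| + tdeg (f k) + freq_bound k < freq k)%N ->
  riesz_coef m = hat (riesz k) m.
Proof.
move=> mk; rewrite -(@riesz_coef_lim (k + `|m|)) ?leq_addl//.
by apply: riesz_stable => //; exact: leq_addr.
Qed.

(** Near the frequency [freq k] the k-th partial product has no spectrum and
    neither has the half of the increment around - [freq k], so the coefficient
    is exactly c_k times a coefficient of [f k] times the k-th product. *)
Lemma riesz_coef_freq k m : (`|m| <= freq_bound k)%N ->
  riesz_coef ((freq k)%:Z - m) = c k * pairing (fun j => riesz_coef (j - m)) (f k).
Proof.
have fk := freq_gt k; have fk1 := freq_gt k.+1.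
move=> mk; rewrite (@riesz_coefE k.+1); last first.
  by have := freq_boundS k; lia.
rewrite rieszS hat_cat riesz_supp ?add0r; last lia.
rewrite hat_increment.
rewrite (@sum_hat0 (fun a => a^*) _ _ (fun i => (freq k)%:Z - m + (freq k)%:Z - i)); last first.
  by move=> i id; apply: riesz_supp; lia.
rewrite addr0 /pairing; congr (_ * _); apply: eq_big_seq => -[a i] /le_tdeg; rewrite [(a, i).2]/= => id.
congr (_ * _); rewrite (@riesz_coefE k (i - m)); last lia.
by congr hat; lia.
Qed.

(** The part of z^(n_k) that is new with respect to the earlier stages
    ([innovation_orth]); the rest of it is c_k f_k. *)
Definition innovation k := (1, (freq k)%:Z) :: tscale (- c k) (f k).

(** This is [riesz_coef_freq] integrated against the monomials of [q]. *)
Lemma innovation_orth k q : (forall y, y \in q -> (`|y.2| <= freq_bound k)%N) ->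
  sesq riesz_coef (innovation k) q = 0.
Proof.
move=> qk; rewrite sesqE exchange_big big_seq big1// => y /qk yk.
rewrite big_cons mul1r riesz_coef_freq// big_map /pairing/=.
set S := \sum_(x <- f k) _; rewrite [X in _ + X](_ : _ = - (c k * y.1^*) * S).
  by ring.
by rewrite mulr_sumr; apply: eq_bigr => x _; ring.
Qed.

Lemma deg_innovation k j y : (k < j)%N -> y \in innovation k ->
  (`|y.2| <= freq_bound j)%N.
Proof.
move=> kj; have := freq_bound_mono kj; rewrite freq_boundS.
case: y => a i h; rewrite inE => /orP[/eqP[_ ->]|/mapP[[b j'] /le_tdeg/= + [_ ->]]].
  by move=> /=; lia.
by lia.
Qed.

Hypothesis f1 : forall k, l1norm (f k) <= 1.
Hypothesis c0 : forall k, 0 <= c k.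
Hypothesis c2 : forall k, c k <= 2^-1.
Hypothesis c_decr : forall k, c k.+1 <= c k.

Let increment_le k m (g : C -> C) (h : int -> int) :
  (forall a, `|g a| = `|a|) -> (forall i, `|hat (riesz k) i| <= 1) ->
  `|c k * (\sum_(x <- f k) g x.1 * hat (riesz k) (h x.2))| <= c k.
Proof.
move=> g1 h1; rewrite normrM (ger0_norm (c0 k)) ler_piMr// (le_trans _ (f1 k))//.
apply: le_trans (ler_norm_sum _ _ _) _; apply: ler_sum => x _.
by rewrite normrM g1 ler_piMr.
Qed.

(** The two halves of the increment have disjoint spectra, so that at each
    frequency only one of them has to be estimated. *)
Lemma increment_coef_le k m : (forall i, `|hat (riesz k) i| <= 1) ->
  `|hat (increment (riesz k) k) m| <= c k.
Proof.
move=> h1; rewrite hat_increment.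
have fk := freq_gt k.
have [m0|m0] := lerP 0 m.
  rewrite (@sum_hat0 (fun a => a^*) _ _ (fun i => m + (freq k)%:Z - i)).
    rewrite addr0; apply: (@increment_le k m id (fun i => m - (freq k)%:Z + i)) => //.
  by move=> i id; apply: riesz_supp; lia.
rewrite (@sum_hat0 id _ _ (fun i => m - (freq k)%:Z + i)).
  rewrite add0r; apply: (@increment_le k m (fun a => a^*) (fun i => m + (freq k)%:Z - i)) => //.
  exact: norm_conjC.
by move=> i id; apply: riesz_supp; lia.
Qed.

(** Each coefficient is either inherited or created by the increment, in which
    case it is at most c_k. *)
Lemma riesz_hat_le1 k m : `|hat (riesz k) m| <= 1.
Proof.
elim: k m => [|k ih] m.
  rewrite /hat big_mkcond big_seq1/=; case: ifP => _; first by rewrite normr1.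
  by rewrite normr0.
have [mk|mk] := ltnP (`|m| + tdeg (f k) + freq_bound k)%N (freq k).
  by rewrite riesz_stableS.
have fk := freq_gt k.
rewrite rieszS hat_cat riesz_supp ?add0r; last lia.
apply: le_trans (increment_coef_le m ih) _.
by apply: le_trans (c2 k) _; rewrite invf_le1 ?ltr0n// ler1n.
Qed.

Lemma c_nincr j k : (j <= k)%N -> c k <= c j.
Proof.
move=> jk; apply: (@homo_leq _ c (fun a b => b <= a)) jk => // a b d ba db.
exact: le_trans db ba.
Qed.

(** A coefficient beyond [freq_bound k] starts at 0 and is created by the
    increment of some stage j >= k, with size at most c_j. *)
Lemma riesz_coef_decay k m : (freq_bound k < `|m|)%N -> `|riesz_coef m| <= c k.
Proof.
move=> km; rewrite -(@riesz_coef_lim (`|m| + k)) ?leq_addr//.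
elim: (`|m|%N) => [|j ih].
  by rewrite riesz_supp// normr0.
have [mj|mj] := ltnP (`|m| + tdeg (f (j + k)) + freq_bound (j + k))%N (freq (j + k)).
  by rewrite addSn riesz_stableS.
have fk := freq_gt (j + k).
rewrite addSn rieszS hat_cat riesz_supp ?add0r; last lia.
apply: le_trans (increment_coef_le m (riesz_hat_le1 _)) _.
exact/c_nincr/leq_addl.
Qed.

(** The new factor is 1 + w + conj w with |w| <= 1/2. *)
Lemma riesz_ge0 k z : `|z| = 1 -> 0 <= ev (riesz k) z.
Proof.
move=> z1; have z0 := norm1_neq0 z1; elim: k => [|k ih].
  by rewrite /ev big_seq1 mul1r expr0z ler01.
rewrite rieszS ev_cat ev_scale ev_cat !ev_mul// ev_conj//.
pose w := c k * (z ^ (- (freq k)%:Z) * ev (f k) z).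
have w_le : `|w| <= 2^-1.
  rewrite normrM normrM norm1_expz// mul1r ger0_norm//.
  by rewrite (le_trans _ (c2 k))// ler_piMr// (le_trans (le_ev_l1 _ z1)).
have wJ : w^* = c k * (z ^ (freq k)%:Z * (ev (f k) z)^*).
  rewrite /w 2!rmorphM/= (CrealP (ger0_real (c0 k))); congr (_ * (_ * _)).
  have zn := norm1_expz (freq k)%:Z z1.
  by rewrite (norm1_conj (norm1_expz _ z1)) invr_expz opprK.
have -> : ev (riesz k) z + c k *
    (ev [:: (1, - (freq k)%:Z)] z * (ev (f k) z * ev (riesz k) z) +
     ev [:: (1, (freq k)%:Z)] z * ((ev (f k) z)^* * ev (riesz k) z)) =
    ev (riesz k) z * (1 + (w + w^*)).
  by rewrite wJ /w !ev_seq1 !mul1r; ring.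
apply: mulr_ge0 => //; rewrite addrC -lerBlDr sub0r.
have wR : w + w^* \is Num.real.
  by rewrite CrealE rmorphD/= conjCK addrC.
have : `|w + w^*| <= 1.
  apply: le_trans (ler_normD _ _) _; rewrite norm_conjC.
  by rewrite [leRHS]splitr mul1r lerD.
by rewrite real_ler_norml// => /andP[].
Qed.

(** Since 2 c_k <= 1, a stage at most doubles the l1-norm. *)
Lemma l1_increment k : l1norm (increment (riesz k) k) <= l1norm (riesz k).
Proof.
rewrite l1_scale l1_cat !l1_mul l1_conj /l1norm !big_seq1/= normr1 !mul1r -!/(l1norm _).
rewrite ger0_norm// (_ : c k * _ = c k * 2 * l1norm (f k) * l1norm (riesz k)); last by ring.
rewrite ler_piMl ?l1_ge0// mulr_ile1 ?mulr_ge0 ?l1_ge0//.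
by rewrite -ler_pdivlMr// mul1r.
Qed.

Lemma l1_riesz k : l1norm (riesz k) <= 2 ^+ k.
Proof.
elim: k => [|k ih]; first by rewrite /l1norm big_seq1 normr1.
rewrite rieszS l1_cat exprS mulr_natl mulr2n lerD//.
exact: le_trans (l1_increment k) ih.
Qed.

Lemma l1_increment_le k : l1norm (increment (riesz k) k) <= 2 ^+ k.
Proof. exact: le_trans (l1_increment k) (l1_riesz k). Qed.

Lemma mem_increment p k x : x \in increment p k ->
  exists i : int, exists2 y, y \in p & (`|i| <= tdeg (f k))%N /\
    (x.2 = - (freq k)%:Z + (i + y.2) \/ x.2 = (freq k)%:Z + (- i + y.2)).
Proof.
move=> /mapP[w]; rewrite mem_cat.
move=> /orP[] /allpairsPdep[u [v [+ + ->]]] ->/=; rewrite inE => /eqP ->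
  /allpairsPdep[u' [y [+ yp ->]]].
  by move=> /le_tdeg uf; exists u'.2, y => //; split=> //; left.
by move=> /mapP[u'' /le_tdeg uf ->]; exists u''.2, y => //; split=> //; right.
Qed.

Lemma deg_riesz k x : x \in riesz k -> (`|x.2| <= freq_bound k)%N.
Proof.
elim: k x => [|k ih] x; first by rewrite inE => /eqP ->.
rewrite rieszS mem_cat freq_boundS => /orP[/ih|].
  by case: x => a i /=; lia.
move=> /mem_increment[i [[b j] /ih/=]]; case: x => a l /=; lia.
Qed.

Lemma freq_increment k x : x \in increment (riesz k) k -> (4 ^ k <= `|x.2|)%N.
Proof.
have : (freq_bound k + tdeg (f k) + 4 ^ k <= freq k)%N.
  by rewrite /freq /freq_after expnS; lia.
move=> fk /mem_increment[i [[b j] /deg_riesz/=]]; case: x => a l /=; lia.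
Qed.

Lemma l1_innovation k : l1norm (innovation k) <= 2.
Proof.
rewrite /l1norm big_cons normr1 -/(l1norm _) l1_scale normrN (ger0_norm (c0 k)).
rewrite [leRHS](_ : 2 = 1 + 1)// lerD2l mulr_ile1 ?l1_ge0//.
by apply: le_trans (c2 k) _; rewrite invf_le1 ?ltr0n// ler1n.
Qed.

End riesz.
End trigpoly.

Local Open Scope complex_scope.
Local Open Scope quotient_scope.

(** * Primitives of trigonometric polynomials *)

Section unit_circle.
Variable R : realType.
Implicit Types (s t : R) (x : R[i] * int) (p q : seq (R[i] * int)).

Definition cis t : R[i] := cos (2 * pi * t) +i* sin (2 * pi * t).

Lemma cisD s t : cis (s + t) = cis s * cis t.
Proof.
rewrite /cis mulrDr cosD sinD; apply/eqP; rewrite eq_complex/=.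
by rewrite eqxx/= addrC [X in X + _]mulrC eqxx.
Qed.

Lemma cis0 : cis 0 = 1.
Proof. by rewrite /cis mulr0 cos0 sin0. Qed.

Lemma cis1 : cis 1 = 1.
Proof. by rewrite /cis mulr1 mulr_natl cos2pi sin2pi. Qed.

Lemma norm_cis t : `|cis t| = 1.
Proof. by rewrite normc_def/= cos2Dsin2 sqrtr1. Qed.

Lemma cisX (m : int) t : cis t ^ m = cis (m%:~R * t).
Proof.
have cN (n : nat) : cis t ^+ n = cis (n%:R * t).
  elim: n => [|n ih]; first by rewrite expr0 mul0r cis0.
  by rewrite exprS ih -cisD -{1}[t]mul1r -mulrDl nat1r.
case: m => n; first by rewrite -exprnP cN.
rewrite NegzE -exprnN cN; apply: (@mulfI _ (cis (n.+1%:R * t))).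
  by rewrite -normr_gt0 norm_cis ltr01.
rewrite mulfV -?cisD; last by rewrite -normr_gt0 norm_cis ltr01.
by rewrite mulrNz mulNr subrr cis0.
Qed.

Lemma is_derive_le (f df : R -> R) s t : (forall a : R, is_derive a 1 f (df a)) ->
  s <= t -> (forall a, s <= a <= t -> 0 <= df a) -> f s <= f t.
Proof.
move=> fdf st df0.
apply: (@ger0_derive1_ndecr _ f s t _ _ _ s t (lexx s) st (lexx t)) => [x _|x xst|].
- by have [] := fdf x.
- rewrite derive1E; have [_ ->] := fdf x; apply: df0.
  by move: xst; rewrite in_itv/= => /andP[/ltW -> /ltW ->].
- by apply: derivable_within_continuous => x _; have [] := fdf x.
Qed.

Lemma is_derive_ndecr (f df : R -> R) : (forall t, is_derive t 1 f (df t)) ->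
  (forall t, 0 <= df t) -> {homo f : s t / s <= t}.
Proof. by move=> fdf df0 s t st; apply: is_derive_le st _. Qed.

Lemma is_derive_lip (f df : R -> R) (L : R) :
  (forall t, is_derive t 1 f (df t)) -> (forall t, `|df t| <= L) ->
  forall s t, s <= t -> `|f t - f s| <= L * (t - s).
Proof.
move=> fdf dfL s t st; rewrite ler_norml; apply/andP; split.
- have H : {homo (L \*: id + f) : a b / a <= b}.
    apply: (@is_derive_ndecr _ (fun t => L *: 1 + df t)) => a.
    by have := dfL a; rewrite ler_norml /GRing.scale/= mulr1 -lerBlDl sub0r => /andP[].
  have : L * s + f s <= L * t + f t := H _ _ st; lra.
- have H : {homo (L \*: id - f) : a b / a <= b}.
    apply: (@is_derive_ndecr _ (fun t => L *: 1 - df t)) => a.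
    by have := dfL a; rewrite ler_norml /GRing.scale/= mulr1 subr_ge0 => /andP[].
  have : L * s - f s <= L * t - f t := H _ _ st; lra.
Qed.

Definition angular_freq (x : R[i] * int) : R := 2 * pi * x.2%:~R.

(** The primitive, vanishing at 0, of the real part of the monomial [x] along
    the circle. *)
Definition primitive1 x t : R :=
  if x.2 == 0 then Re x.1 * t
  else (angular_freq x)^-1 * (Re x.1 * sin (angular_freq x * t) + Im x.1 * (cos (angular_freq x * t) - 1)).

Lemma two_pi_ge4 : 4 <= 2 * pi :> R.
Proof. have := @pi_ge2 R; lra. Qed.

Lemma is_derive_primitive1 x t :
  is_derive t 1 (primitive1 x) (Re (x.1 * cis t ^ x.2)).
Proof.
rewrite cisX Defs.ReM /=; have [x0|x0] := eqVneq x.2 0.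
  rewrite (_ : primitive1 x = Re x.1 \*: id); last first.
    by apply/funext => s; rewrite /primitive1 x0 eqxx.
  rewrite x0 mul0r mulr0 cos0 sin0 mulr0 subr0.
  by apply: is_derive_eq.
have w0 : angular_freq x != 0.
  rewrite mulf_neq0 ?intr_eq0//; have := two_pi_ge4; lra.
have <- : angular_freq x * t = 2 * pi * (x.2%:~R * t) by rewrite mulrA.
have dl : is_derive t 1 (angular_freq x \*: (@id R)) (angular_freq x).
  by apply: is_derive_eq; rewrite /GRing.scale/= mulr1.
have dp : is_derive t 1 ((angular_freq x)^-1 \*: (Re x.1 \*: (sin \o (angular_freq x \*: (@id R))) +
     Im x.1 \*: ((cos \o (angular_freq x \*: (@id R))) - cst 1)))
   (Re x.1 * cos (angular_freq x * t) - Im x.1 * sin (angular_freq x * t)).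
  apply: is_derive_eq; rewrite -[LHS]/((angular_freq x)^-1 *
    (Re x.1 * (cos (angular_freq x * t) * angular_freq x) +
     Im x.1 * (- sin (angular_freq x * t) * angular_freq x - 0))).
  by field.
suff -> : primitive1 x = ((angular_freq x)^-1 \*: (Re x.1 \*: (sin \o (angular_freq x \*: (@id R))) +
     Im x.1 \*: ((cos \o (angular_freq x \*: (@id R))) - cst 1))) by exact: dp.
by apply/funext => s; rewrite /primitive1 (negbTE x0).
Qed.

Definition primitive p t : R := \sum_(x <- p) primitive1 x t.

Lemma is_derive_primitive p t : is_derive t 1 (primitive p) (Re (ev p (cis t))).
Proof.
elim: p => [|x p ih].
  rewrite /primitive /ev big_nil (_ : (fun _ => _) = cst 0).
    exact: is_derive_cst.
  by apply/funext => s; rewrite big_nil.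
rewrite /ev big_cons -/(ev _ _) Defs.ReD.
have d1 := is_derive_primitive1 x t.
suff -> : primitive (x :: p) = primitive1 x + primitive p by exact: is_deriveD.
by apply/funext => s; rewrite /primitive big_cons.
Qed.

Lemma primitive_cat p q t : primitive (p ++ q) t = primitive p t + primitive q t.
Proof. by rewrite /primitive big_cat. Qed.

Lemma primitive0 p : primitive p 0 = 0.
Proof.
rewrite /primitive big1// => x _; rewrite /primitive1 !mulr0 sin0 cos0.
by rewrite subrr !mulr0 addr0 mulr0 if_same.
Qed.

(** Over a full turn all nonconstant monomials integrate to 0. *)
Lemma primitive1_at1 x : primitive1 x 1 = if x.2 == 0 then Re x.1 else 0.
Proof.
rewrite /primitive1; case: ifP => _; first by rewrite mulr1.
have : cis x.2%:~R = 1 by rewrite -[x.2%:~R]mulr1 -cisX cis1 exp1rz.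
rewrite /cis /angular_freq mulr1 => -[-> ->].
by rewrite subrr !mulr0 addr0 mulr0.
Qed.

Lemma primitive_at1 p : primitive p 1 = Re (hat p 0).
Proof.
elim: p => [|x p ih]; first by rewrite /primitive /hat !big_nil.
rewrite /primitive /hat !big_cons -!/(hat _ _) -/(primitive _ _) ih primitive1_at1 oppr0.
by case: ifP => _; rewrite ?Defs.ReD ?add0r// /hat oppr0.
Qed.

Lemma normr_Re_le (z : R[i]) : `|Re z| <= normc z.
Proof. by rewrite -lecR; exact: normc_ge_Re. Qed.

Lemma normr_Im_le (z : R[i]) : `|Im z| <= normc z.
Proof. by rewrite -lecR; exact: normc_ge_Im. Qed.

Lemma primitive1_le x t : x.2 != 0 ->
  `|primitive1 x t| <= normc x.1 / `|x.2|%:R.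
Proof.
move=> x0; rewrite /primitive1 (negbTE x0).
have n0 : 0 < `|x.2|%:R :> R by rewrite ltr0n absz_gt0.
have w4 : 4 * `|x.2|%:R <= `|angular_freq x|.
  rewrite normrM -intr_norm -abszE ger0_norm; last by have := two_pi_ge4; lra.
  by rewrite ler_pM2r ?two_pi_ge4.
have N0 : 0 <= normc x.1 by exact: le_trans (normr_ge0 _) (normr_Re_le _).
have S3 : `|Re x.1 * sin (angular_freq x * t) + Im x.1 * (cos (angular_freq x * t) - 1)| <= 4 * normc x.1.
  apply: le_trans (ler_normD _ _) _; rewrite !normrM.
  have h1 : `|Re x.1| * `|sin (angular_freq x * t)| <= normc x.1 * 1.
    by rewrite ler_pM// ?normr_Re_le// ler_norml sin_geN1 sin_le1.
  have h2 : `|Im x.1| * `|cos (angular_freq x * t) - 1| <= normc x.1 * 2.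
    rewrite ler_pM// ?normr_Im_le// ler_norml.
    by have := cos_geN1 (angular_freq x * t); have := cos_le1 (angular_freq x * t); lra.
  lra.
rewrite normrM normfV mulrC ler_pdivrMr; last by apply: lt_le_trans w4; rewrite mulr_gt0.
apply: le_trans S3 _; rewrite mulrAC ler_pdivlMr//.
by rewrite mulrAC [leRHS]mulrC ler_wpM2r.
Qed.

Lemma l1_normc p (M : R) : l1norm p <= M%:C -> \sum_(x <- p) normc x.1 <= M.
Proof.
suff -> : l1norm p = (\sum_(x <- p) normc x.1)%:C by rewrite lecR.
by rewrite rmorph_sum.
Qed.

(** High frequencies have small primitives; this is what makes the
    distribution functions of the partial products converge. *)
Lemma primitive_le p (M : R) (N : nat) t : l1norm p <= M%:C -> (0 < N)%N ->
  (forall x, x \in p -> (N <= `|x.2|)%N) -> `|primitive p t| <= M / N%:R.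
Proof.
move=> /l1_normc pM N0 pN; apply: le_trans (ler_norm_sum _ _ _) _.
have N0' : 0 < N%:R :> R by rewrite ltr0n.
apply: (@le_trans _ _ (\sum_(x <- p) normc x.1 / N%:R)); last first.
  by rewrite -mulr_suml ler_wpM2r// invr_ge0 ltW.
rewrite big_seq [leRHS]big_seq; apply: ler_sum => x xp; have xN := pN _ xp.
have x0 : (0 < `|x.2|)%N := leq_trans N0 xN.
apply: le_trans (primitive1_le _ _) _; first by rewrite -absz_gt0.
rewrite ler_wpM2l//; first exact: le_trans (normr_ge0 _) (normr_Re_le _).
by rewrite lef_pV2 ?posrE ?ltr0n// ler_nat.
Qed.

Lemma primitive_continuous p : continuous (primitive p).
Proof.
move=> t; apply: differentiable_continuous; apply/derivable1_diffP.
by have [] := is_derive_primitive p t.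
Qed.

Lemma primitive_ndecr p : (forall t, 0 <= ev p (cis t)) ->
  {homo primitive p : s t / s <= t}.
Proof.
move=> p0; apply: (is_derive_ndecr (is_derive_primitive p)) => t.
by have := p0 t; rewrite lecE => /andP[].
Qed.

Lemma wave_lip (b : R[i]) (m : int) : normc b <= 1 ->
  forall s t, s <= t -> `|Re (b * cis t ^ m) - Re (b * cis s ^ m)| <=
    (4 * pi * `|m|%:R) * (t - s).
Proof.
move=> b1; pose w := 2 * pi * m%:~R : R.
have bR := le_trans (normr_Re_le b) b1; have bI := le_trans (normr_Im_le b) b1.
have dl t : is_derive t 1 (w \*: (@id R)) w.
  by apply: is_derive_eq; rewrite /GRing.scale/= mulr1.
have E : (fun t => Re (b * cis t ^ m)) = (Re b \*: (cos \o (w \*: (@id R))) - Im b \*: (sin \o (w \*: (@id R))) : R -> R).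
  apply/funext => t; rewrite cisX Defs.ReM /=.
  by rewrite mulrA -/w.
have D t : is_derive t 1 (fun t => Re (b * cis t ^ m)) (Re b * (- sin (w * t) * w) - Im b * (cos (w * t) * w)).
  by rewrite E; apply: is_derive_eq.
apply: (is_derive_lip D) => t; apply: le_trans (ler_normB _ _) _.
have -> : 4 * pi * `|m|%:R = 1 * (1 * `|w|) + 1 * (1 * `|w|) :> R.
  rewrite normrM -intr_norm -abszE ger0_norm; last by have := two_pi_ge4; lra.
  by ring.
rewrite !normrM normrN.
have s1 : `|sin (w * t)| <= 1 by rewrite ler_norml sin_geN1 sin_le1.
have c1 : `|cos (w * t)| <= 1 by rewrite ler_norml cos_geN1 cos_le1.
by apply: lerD; do 2?rewrite ler_pM ?mulr_ge0//.
Qed.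

(** On a short interval the wave g(t) = Re (b e(mt)) is almost constant, so its
    integral against the positive density [ev p] is almost g(s) times the mass of
    the interval.  Both sides are primitives, and the comparison is made on their
    derivatives. *)
Lemma primitive_wave p (b : R[i]) (m : int) (L : R) s t : (forall t, 0 <= ev p (cis t)) ->
  s <= t ->
  (forall a, s <= a <= t -> `|Re (b * cis a ^ m) - Re (b * cis s ^ m)| <= L) ->
  `|primitive (tmul [:: (b, m)] p) t - primitive (tmul [:: (b, m)] p) s
    - Re (b * cis s ^ m) * (primitive p t - primitive p s)| <=
  L * (primitive p t - primitive p s).
Proof.
move=> p0 st gL; pose g t := Re (b * cis t ^ m); pose q := tmul [:: (b, m)] p.
rewrite -[X in `|_ - X * _|]/(g s) -/q.
have dq (a : R) : is_derive a 1 (primitive q) (g a * Re (ev p (cis a))).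
  suff -> : g a * Re (ev p (cis a)) = Re (ev q (cis a)) by exact: is_derive_primitive.
  rewrite ev_mul ?norm1_neq0 ?norm_cis// ev_seq1 [in RHS]Defs.ReM.
  by rewrite (ger0_Im (p0 a)) mulr0 subr0.
have dp := is_derive_primitive p.
have P0 a : 0 <= Re (ev p (cis a)) by have := p0 a; rewrite lecE => /andP[].
have {}gL a : s <= a <= t -> `|g a - g s| <= L := gL a.
have gs : g s = Re (b * cis s ^ m) by [].
move: (g) dq gs gL => h dq _ gL {g}.
rewrite ler_norml; apply/andP; split.
- suff : (L - h s) * primitive p s + primitive q s <= (L - h s) * primitive p t + primitive q t by lra.
  apply: (@is_derive_le ((L - h s) \*: primitive p + primitive q)
    (fun a => (L - h s) *: Re (ev p (cis a)) + h a * Re (ev p (cis a)))) => // a /gL.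
  rewrite ler_norml => /andP[gl gu].
  by rewrite -[_ *: _]/(_ * _) -mulrDl mulr_ge0//; lra.
- suff : (L + h s) * primitive p s - primitive q s <= (L + h s) * primitive p t - primitive q t by lra.
  apply: (@is_derive_le ((L + h s) \*: primitive p - primitive q)
    (fun a => (L + h s) *: Re (ev p (cis a)) - h a * Re (ev p (cis a)))) => // a /gL.
  rewrite ler_norml => /andP[gl gu].
  by rewrite -[_ *: _]/(_ * _) -mulrBl mulr_ge0//; lra.
Qed.
End unit_circle.

(** * Distribution functions and Riemann-Stieltjes sums *)

Section cdf.
Variable R : realType.

(** Here [Phi] and [Psi] play the roles of the indefinite integrals of [g]
    against dF and dG.  Each is compared with its Riemann sum over N equal steps,
    and the two Riemann sums differ by at most 2 eta per step. *)
Lemma riemann_sum_compare (Phi Psi F G g : R -> R) (L eta : R) (N : nat) :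
  (0 < N)%N -> (forall t, `|g t| <= 1) -> (forall t, `|F t - G t| <= eta) ->
  (forall s t, 0 <= s -> s <= t -> t <= 1 ->
    `|Phi t - Phi s - g s * (F t - F s)| <= L * (t - s) * (F t - F s)) ->
  (forall s t, 0 <= s -> s <= t -> t <= 1 ->
    `|Psi t - Psi s - g s * (G t - G s)| <= L * (t - s) * (G t - G s)) ->
  `|(Phi 1 - Phi 0) - (Psi 1 - Psi 0)| <=
    L / N%:R * ((F 1 - F 0) + (G 1 - G 0)) + N%:R * (2 * eta).
Proof.
move=> N0 g1 FG hF hG.
have N0' : 0 < N%:R :> R by rewrite ltr0n.
pose x n : R := n%:R / N%:R.
have main n : (n <= N)%N -> `|(Phi (x n) - Phi 0) - (Psi (x n) - Psi 0)| <=
    L / N%:R * ((F (x n) - F 0) + (G (x n) - G 0)) + n%:R * (2 * eta).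
  elim: n => [|n ih] nN; first by rewrite /x !mul0r !subrr normr0 !addr0 mulr0 ?mul0r ?addr0.
  have {}ih := ih (ltnW nN).
  have x0 : 0 <= x n by rewrite divr_ge0.
  have xS : x n.+1 - x n = N%:R^-1 by rewrite /x -mulrBl -natr1 addrAC subrr add0r mul1r.
  have xx : x n <= x n.+1 by rewrite -subr_ge0 xS invr_ge0 ltW.
  have x1 : x n.+1 <= 1 by rewrite /x ler_pdivrMr// mul1r ler_nat.
  have := hF _ _ x0 xx x1; have := hG _ _ x0 xx x1; rewrite xS.
  have := FG (x n); have := FG (x n.+1); have := g1 (x n).
  move: ih; rewrite -[n.+1%:R](natr1 n).
  move: (Phi (x n)) (Phi (x n.+1)) (Psi (x n)) (Psi (x n.+1)) (F (x n)) (F (x n.+1))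
    (G (x n)) (G (x n.+1)) (g (x n)) => a a' b b' c c' d d' e.
  set k := L / N%:R => ih e1 h1 h2 h3 h4.
  have h5 : `|e * ((c' - d') - (c - d))| <= 2 * eta.
    rewrite normrM -[leRHS]mul1r ler_pM// (le_trans (ler_normB _ _))//.
    by rewrite mulr_natl mulr2n lerD.
  rewrite (_ : a' - _ - _ = (a - Phi 0 - (b - Psi 0)) + (a' - a - e * (c' - c))
    - (b' - b - e * (d' - d)) + e * ((c' - d') - (c - d))); last by ring.
  have -> : k * (c' - F 0 + (d' - G 0)) + (n%:R + 1) * (2 * eta) =
    k * (c - F 0 + (d - G 0)) + n%:R * (2 * eta) + k * (c' - c) + k * (d' - d) + 2 * eta.
    by ring.
  by do 3 (apply: le_trans (ler_normD _ _) _; apply: lerD; rewrite ?normrN//).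
have := main N (leqnn N); rewrite /x mulfV//; exact: lt0r_neq0.
Qed.

Lemma cdf_probability (F : R -> R) : {homo F : s t / s <= t} -> continuous F ->
  F 0 = 0 -> F 1 = 1 ->
  exists P : probability (measurableTypeR R) R, forall t, 0 <= t <= 1 -> P `]0, t]%classic = (F t)%:E.
Proof.
move=> Fnd Fc F0 F1.
(* F is frozen outside [0, 1] so that it has limits 0 and 1 at infinity. *)
pose clip t : R := Num.max 0 (Num.min 1 t).
have clip_nd : {homo clip : s t / s <= t}.
  move=> s t st; rewrite /clip.
  case: (lerP 1 s) => s1; case: (lerP 1 t) => t1; rewrite ?(max_r ler01) //.
  - lra.
  - by rewrite ge_max ler01 ltW.
  - by rewrite ge_max le_max lexx/= le_max st orbT.
have clip_id t : 0 <= t <= 1 -> clip t = t.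
  by move=> /andP[t0 t1]; rewrite /clip min_r// max_r.
have nd : {homo (F \o clip) : s t / s <= t} by move=> s t /clip_nd /Fnd.
have clipc : continuous clip.
  move=> t; apply: continuous_max; first exact: cvg_cst.
  by apply: continuous_min; [exact: cvg_cst|exact: cvg_id].
have c : continuous (F \o clip).
  by move=> t; apply: continuous_comp; [exact: clipc|exact: Fc].
have rc := right_continuousW c.
have FNy : (F \o clip) t @[t --> -oo] --> (0 : R).
  apply: cvg_near_cst; exists 0; split => // t t0.
  by rewrite /= /clip min_r ?(le_trans (ltW t0))// max_l// ltW.
have Fy : (F \o clip) t @[t --> +oo] --> (1 : R).
  apply: cvg_near_cst; exists 1; split => // t t0.
  by rewrite /= /clip min_l ?max_r// ltW.
pose Fb : cumulativeBounded (0:R) (1:R) := HB.pack (F \o clip)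
  (isCumulative.Build R _ R (F \o clip) nd rc)
  (isCumulativeBounded.Build R 0 1 (F \o clip) FNy Fy).
exists (lebesgue_stieltjes_measure Fb) => t /andP[t0 t1].
rewrite /= /lebesgue_stieltjes_measure /measure_extension measurable_mu_extE/=; last exact: is_ocitv.
by rewrite wlength_itv_bnd//= !clip_id ?lexx ?ler01 ?t0 ?t1// F0 subr0.
Qed.

(** On ]s, t] the function [g] differs from [g s] by at most L (t - s); the
    estimate is put in the form that [riemann_sum_compare] asks for. *)
Lemma cdf_integral (P : probability (measurableTypeR R) R) (F g : R -> R) (L : R) :
  (forall t, 0 <= t <= 1 -> P `]0, t]%classic = (F t)%:E) -> F 1 = 1 ->
  continuous g -> (forall t, `|g t| <= 1) ->
  (forall s t, s <= t -> `|g t - g s| <= L * (t - s)) ->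
  [/\ Rintegral P setT g = Rintegral P `]0, 1]%classic g,
   Rintegral P `]0, 0]%classic g = 0 &
  forall s t, 0 <= s -> s <= t -> t <= 1 ->
    `|Rintegral P `]0, t]%classic g - Rintegral P `]0, s]%classic g - g s * (F t - F s)| <= L * (t - s) * (F t - F s)].
Proof.
move=> PF F1 gc g1 gL.
have mg : measurable_fun setT g by exact: continuous_measurable_fun.
have gi : P.-integrable setT (EFin \o g).
  apply: measurable_bounded_integrable => //.
    exact: le_lt_trans (probability_le1 P measurableT) (ltry _).
  by exists 1; split => // M M1 t _; exact: le_trans (g1 t) (ltW M1).
have giD (D : set R) : measurable D -> P.-integrable D (EFin \o g).
  by move=> mD; apply: integrableS gi.
split.
- rewrite /Rintegral (@negligible_integral _ _ _ P setT (~` `]0, 1]%classic)) ?setDE ?setTI ?setCK//.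
    exact: measurableC.
  rewrite [LHS](probability_setC P (@measurable_itv R `]0, 1]))//.
  by rewrite PF ?F1 ?subee// ler01 lexx.
- by rewrite set_itvoc0 Rintegral_set0.
move=> s t s0 st t1.
have tU : `]0, t]%classic = `]0, s]%classic `|` `]s, t]%classic :> set R.
  apply/seteqP; split => a; rewrite /= !in_itv/=.
    by move=> /andP[-> ->]; rewrite andbT /=; case: (lerP a s); [left|right].
  by move=> [/andP[-> /le_trans->]//|/andP[sa ->]]; rewrite (le_lt_trans s0 sa).
have st0 : [disjoint `]0, s]%classic & `]s, t]%classic].
  apply/disj_set2P/seteqP; split => a //=; rewrite !in_itv/= => -[/andP[_ aS] /andP[+ _]].
  by rewrite ltNge aS.
rewrite {1}tU Rintegral_setU//; last exact/giD/measurableU.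
rewrite [X in X - _ - _]addrC addrK.
have Pst : P `]s, t]%classic = (F t - F s)%:E.
  pose A : set R := `]0, s]%classic; pose B : set R := `]s, t]%classic.
  have PU : P (A `|` B) = (P A + P B)%E.
    have AB0 : A `&` B = set0 by exact/disj_set2P.
    exact: (@measureU _ _ _ P A B (@measurable_itv R _) (@measurable_itv R _) AB0).
  have Ps : P A = (F s)%:E by rewrite PF// s0 (le_trans st).
  have Pt : P (A `|` B) = (F t)%:E by rewrite -tU PF// (le_trans s0 st).
  move: Pt; rewrite PU Ps /B.
  rewrite -[P `]s, t]%classic]fineK ?fin_num_measure// -EFinD => -[<-].
  by rewrite addrC addKr.
have ci (r : R) : P.-integrable `]s, t]%classic (EFin \o cst r).
  exact/finite_measure_integrable_cst.
have Fst : fine (P `]s, t]%classic) = F t - F s by rewrite Pst.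
rewrite -Fst -!Rintegral_cst// -RintegralB//; last 2 first.
- exact: giD.
- exact: ci.
have gs : P.-integrable `]s, t]%classic (EFin \o (fun x => g x - g s)).
  rewrite (_ : _ \o _ = ((EFin \o g) \- (EFin \o cst (g s)))%E); last by apply/funext.
  by apply: integrableB => //; exact: giD.
apply: le_trans (le_normr_Rintegral _ gs) _ => //.
apply: le_Rintegral => //.
- exact: (integrable_norm gs).
- exact: ci.
move=> x; rewrite /= in_itv/= => /andP[sx xt].
apply: le_trans (gL _ _ (ltW sx)) _; rewrite ler_wpM2l ?lerB//.
have := gL s (s + 1); rewrite lerDl ler01 addrAC subrr add0r mulr1 => /(_ isT).
exact: le_trans.
Qed.

End cdf.

(** * The limit of the partial products *)

Section limit_measure.
Variable R : realType.

Lemma eq0_le_half (x M : R) : (forall j, `|x| <= M / 2 ^+ j) -> x = 0.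
Proof.
move=> xM; apply/eqP; rewrite -normr_le0 leNgt; apply/negP => x0.
have := archi_boundP (normr_ge0 (M / `|x|)); set j := Num.bound _ => Mj.
have := xM j; apply/negP; rewrite -ltNge ltr_pdivrMr ?exprn_gt0//.
rewrite mulrC -ltr_pdivrMr//; apply: le_lt_trans (ler_norm _) _.
by apply: lt_trans Mj _; rewrite -natrX ltr_nat ltn_expl.
Qed.

Lemma normc_le_ReIm (z : R[i]) : normc z <= `|Re z| + `|Im z|.
Proof.
rewrite {1}[z]complexE; apply: le_trans (le_normcD _ _) _; rewrite normcM.
by rewrite /= !expr0n/= !expr1n !addr0 add0r !sqrtr_sqr sqrtr1 mul1r.
Qed.

Lemma cis_lip (s t : R) : s <= t -> normc (cis t - cis s) <= 8 * pi * (t - s).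
Proof.
move=> st; apply: le_trans (normc_le_ReIm _) _; rewrite Defs.ReD Defs.ImD.
have n1 : normc (1 : R[i]) <= 1 by rewrite normc1.
have ni : normc (- 'i : R[i]) <= 1.
  by rewrite normcN /= expr0n/= expr1n add0r sqrtr1.
have := @wave_lip R _ 1 n1 s t st; have := @wave_lip R _ 1 ni s t st.
rewrite !expr1z !mul1r !Defs.ReM /= mulr1.
rewrite !oppr0 !mul0r !add0r !mulN1r !opprK => h1 h2.
by apply: le_trans (lerD h2 h1) _; rewrite le_eqVlt; apply/orP; left; apply/eqP; ring.
Qed.

Lemma cis_continuous : continuous (@cis R).
Proof.
move=> t; apply/(@cvgrPdist_lt _ R[i]^o) => e e0.
have eE : e = (Re e)%:C by rewrite RRe_real// gtr0_real.
have {}e0 : 0 < Re e by rewrite -ltcR -eE.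
have pi8 : 0 < 8 * pi :> R by rewrite mulr_gt0// pi_gt0.
have := nbhsx_ballx t _ (divr_gt0 e0 pi8); apply: filterS => x.
rewrite -ball_normE /= ltr_pdivlMr// mulrC => txe.
rewrite eE ltcR; apply: le_lt_trans txe.
have [tx|/ltW tx] := lerP t x.
  by rewrite -normcN opprB (le_trans (cis_lip tx))// ler_wpM2l ?(ltW pi8)// distrC ler_norm.
by rewrite (le_trans (cis_lip tx))// ler_wpM2l ?(ltW pi8)// ler_norm.
Qed.

Definition cis_circle (t : measurableTypeR R) : borel (circle R) :=
  exist _ (cis t) (introT eqP (norm_cis t)).

(** The Borel sets of the circle are generated by traces of open sets of the
    plane, whose preimages under the continuous parametrisation are open. *)
Lemma measurable_cis_circle :
  measurable_fun [set: measurableTypeR R] cis_circle.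
Proof.
apply: (@measurability _ _ _ _ setT cis_circle (@open (circle R)) erefl).
move=> _ [V [W oW <-] <-]; rewrite setTI.
apply: open_measurable; have /continuousP := cis_continuous; exact.
Qed.

(** On the circle negative powers are conjugates of positive ones. *)
Lemma cmeasurable_expz (m : int) :
  cmeasurable (fun z : borel (circle R) => sval z ^ m).
Proof.
have cX n : cmeasurable (fun z : borel (circle R) => sval z ^+ n).
  elim: n => [|n ih]; first exact: cmeasurable_cst.
  under eq_fun do rewrite exprS.
  by apply: cmeasurableM => //; exact: circle_cmeasurable.
case: m => n; first exact: cX.
rewrite (_ : (fun _ => _) = (fun z : borel (circle R) => (sval z ^+ n.+1)^*)).
  have [h1 h2] := cX n.+1; split.
    rewrite (_ : (fun _ => _) = (fun z : borel (circle R) => Re (sval z ^+ n.+1)))//.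
    by apply/funext => z; case: (_ ^+ _).
  rewrite (_ : (fun _ => _) = (fun z : borel (circle R) => - Im (sval z ^+ n.+1))).
    exact: measurable_funN.
  by apply/funext => z; case: (_ ^+ _).
apply/funext => z; rewrite NegzE -exprnN.
by rewrite -norm1_conj// normrX (eqP (svalP z)) expr1n.
Qed.

Variables (S d : nat -> seq (R[i] * int)).
Hypothesis S0 : S 0%N = [:: (1, 0)].
Hypothesis SS : forall k, S k.+1 = S k ++ d k.
Hypothesis S_ge0 : forall k t, 0 <= ev (S k) (cis t).
Hypothesis d_l1 : forall k, l1norm (d k) <= 2 ^+ k.
Hypothesis d_freq : forall k x, x \in d k -> (4 ^ k <= `|x.2|)%N.

Let G k := primitive (S k).
Let r k : R := 2 / 2 ^+ k.

(** A primitive gains a factor 4^(-k) from the frequencies, against an l1-norm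
    of at most 2^k. *)
Let G_step k t : `|G k.+1 t - G k t| <= r k - r k.+1.
Proof.
rewrite /G SS primitive_cat addrC addKr.
have -> : r k - r k.+1 = 2 ^+ k / (4 ^ k)%:R.
  have k0 : 2 ^+ k != 0 :> R by rewrite expf_neq0.
  rewrite natrX (_ : 4%:R = 2 * 2 :> R); last by rewrite -natrM.
  rewrite exprMn /r exprS; field; exact: k0.
apply: primitive_le => //; last exact: d_freq.
- by rewrite rmorphXn/= rmorph_nat.
- by rewrite expn_gt0.
Qed.

(** The bounds G_k - r_k increase and the bounds G_k + r_k decrease
    ([hi_ni]), so they enclose the limit; its existence and the rate of
    convergence both come from this nesting. *)
Let lo_nd t j k : (j <= k)%N -> G j t - r j <= G k t - r k.
Proof.
move=> /subnK <-; elim: (k - j)%N => // i ih; apply: le_trans ih _.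
by have := G_step (i + j) t; rewrite addSn ler_norml => /andP[]; lra.
Qed.

Let hi_ni t j k : (j <= k)%N -> G k t + r k <= G j t + r j.
Proof.
move=> /subnK <-; elim: (k - j)%N => // i ih; apply: le_trans ih.
by have := G_step (i + j) t; rewrite addSn ler_norml => /andP[]; lra.
Qed.

Let r_ge0 k : 0 <= r k.
Proof. by rewrite /r divr_ge0// exprn_ge0. Qed.

Let lo_hi t j k : G j t - r j <= G k t + r k.
Proof.
apply: (le_trans (lo_nd t (leq_maxl j k))); apply: le_trans (hi_ni t (leq_maxr j k)).
by have := r_ge0 (maxn j k); lra.
Qed.

Let F t := sup [set G k t - r k | k in [set: nat]].

Let F_approx k t : `|F t - G k t| <= r k.
Proof.
rewrite ler_norml; apply/andP; split.
- suff : G k t - r k <= F t by lra.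
  apply: ub_le_sup; last by exists k.
  by exists (G 0%N t + r 0%N) => _ [j _ <-]; exact: lo_hi.
- suff : F t <= G k t + r k by lra.
  apply: ge_sup; first by exists (G 0%N t - r 0%N), 0%N.
  by move=> _ [j _ <-]; exact: lo_hi.
Qed.

(** Estimates with an error proportional to [r k] pass to the limit. *)
Let F_squeeze (x M : R) (k0 : nat) : (forall k, (k0 <= k)%N -> `|x| <= M * r k) -> x = 0.
Proof.
move=> h; apply: (@eq0_le_half _ (`|M| * 2)) => j.
apply: le_trans (h (k0 + j)%N (leq_addr _ _)) _; rewrite /r.
apply: (@le_trans _ _ (`|M| * (2 / 2 ^+ (k0 + j)))).
  by rewrite ler_wpM2r// ?ler_norm// r_ge0.
by rewrite -mulrA ler_wpM2l// ler_wpM2l// lef_pV2 ?posrE ?exprn_gt0// ler_eXn2l ?leq_addl// ltr1n.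
Qed.

Let F_nd : {homo F : s t / s <= t}.
Proof.
move=> s t st; rewrite -subr_ge0 leNgt; apply/negP => Fst.
suff : F t - F s = 0 by move=> E; rewrite E ltxx in Fst.
apply: (@F_squeeze _ 2 0%N) => k _; rewrite ltr0_norm//.
have : G k s <= G k t by apply: primitive_ndecr.
have := F_approx k s; have := F_approx k t; rewrite !ler_norml.
by move=> /andP[? ?] /andP[? ?]; lra.
Qed.

Let F0 : F 0 = 0.
Proof.
apply: (@F_squeeze _ 1 0%N) => k _.
by have := F_approx k 0; rewrite /G primitive0 subr0 mul1r.
Qed.

Let G1 k : G k 1 = 1.
Proof.
rewrite /G primitive_at1; elim: k => [|k ih].
  by rewrite S0 /hat big_mkcond big_seq1.
rewrite SS hat_cat Defs.ReD ih (_ : hat (d k) 0 = 0) ?addr0//.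
rewrite /hat big_seq_cond big1// => x /andP[/d_freq h /eqP x0].
by move: h; rewrite x0 oppr0 absz0 leqn0 expn_eq0.
Qed.

Let F1 : F 1 = 1.
Proof.
apply/eqP; rewrite -subr_eq0; apply/eqP; apply: (@F_squeeze _ 1 0%N) => k _.
by have := F_approx k 1; rewrite G1 mul1r.
Qed.

Let F_continuous : continuous F.
Proof.
move=> t; apply/(@cvgrPdist_lt _ R^o) => e e0.
have [k ke] : exists k, r k < e / 4.
  apply: contrapT => H.
  suff : e = 0 by move=> E; rewrite E ltxx in e0.
  apply: (@F_squeeze _ 4 0%N) => k _; rewrite gtr0_norm//.
  have : e / 4 <= r k by rewrite leNgt; apply/negP => h; apply: H; exists k.
  lra.
have /(@cvgrPdist_lt _ R^o) /(_ (e / 4)) := @primitive_continuous R (S k) t.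
have e4 : 0 < e / 4 by lra.
move=> /(_ e4); apply: filterS => x; rewrite -/(G k) => h.
have := F_approx k t; have := F_approx k x; move: h.
rewrite ltr_norml !ler_norml => /andP[? ?] /andP[? ?] /andP[? ?].
by rewrite ltr_norml; apply/andP; split; lra.
Qed.

(** The integral against dF and the coefficient of a partial product have
    nearby Riemann sums; refining the partition while the index of the product
    grows makes the error disappear. *)
Let integral_wave (P : probability (measurableTypeR R) R) (b a : R[i]) (m : int) (K : nat) :
  (forall t, 0 <= t <= 1 -> P `]0, t]%classic = (F t)%:E) ->
  normc b <= 1 -> (forall k, (K <= k)%N -> hat (S k) m = a) ->
  Rintegral P setT (fun t => Re (b * cis t ^ m)) = Re (b * a).
Proof.
move=> PF b1 ha; pose g t := Re (b * cis t ^ m); rewrite -/g.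
pose L := 4 * pi * `|m|%:R : R.
have gL s t : s <= t -> `|g t - g s| <= L * (t - s) by exact: wave_lip.
have g1 t : `|g t| <= 1.
  apply: le_trans (normr_Re_le _) _; rewrite normcM.
  suff -> : normc (cis t ^ m) = 1 by rewrite mulr1.
  by apply: complexI; apply: norm1_expz; exact: norm_cis.
have gc : continuous g.
  move=> t; apply/(@cvgrPdist_lt _ R^o) => e e0.
  have L1 : 0 < L + 1 by rewrite ltr_wpDl// /L !mulr_ge0// pi_ge0.
  have := nbhsx_ballx t _ (divr_gt0 e0 L1); apply: filterS => x.
  rewrite -ball_normE /= ltr_pdivlMr// mulrDr mulr1 [_ * L]mulrC => txe.
  apply: le_lt_trans txe; apply: (@le_trans _ _ (L * `|t - x|)); last by rewrite lerDl.
  have [tx|/ltW tx] := lerP t x.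
    by rewrite distrC (le_trans (gL _ _ tx))// ler0_norm ?opprB// subr_le0.
  by rewrite (le_trans (gL _ _ tx))// ger0_norm// subr_ge0.
have [gT gz gI] := cdf_integral PF F1 gc g1 gL.
have L0 : 0 <= L by rewrite /L !mulr_ge0// pi_ge0.
apply/eqP; rewrite -subr_eq0; apply/eqP; apply: (@eq0_le_half _ (2 * L + 4)) => j.
(* With 2^j steps and distribution functions at distance r k, of order
   2^(- 2 j), both error terms are O (2^(-j)). *)
pose k := (2 * j + K)%N.
have := @riemann_sum_compare R (fun t => Rintegral P `]0, t]%classic g)
  (primitive (tmul [:: (b, m)] (S k))) F (G k) g L (r k) (2 ^ j)%N.
rewrite expn_gt0/= => /(_ isT g1 (F_approx k) gI).
have H s t : 0 <= s -> s <= t -> t <= 1 -> `|primitive (tmul [:: (b, m)] (S k)) t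
    - primitive (tmul [:: (b, m)] (S k)) s - g s * (G k t - G k s)| <= L * (t - s) * (G k t - G k s).
  move=> s0 st t1; apply: primitive_wave => // x /andP[sx xt].
  by apply: le_trans (gL _ _ sx) _; rewrite ler_wpM2l// lerB.
move=> /(_ H); rewrite F0 F1 G1 /G !primitive0 !subr0 gz subr0 gT.
rewrite primitive_at1 hat_shift add0r ha; last by rewrite /k leq_addl.
move=> /le_trans; apply; rewrite natrX.
rewrite [leRHS]mulrDl lerD//.
  by rewrite mulrAC [2 * L]mulrC.
rewrite /r /k exprD mul2n -addnn exprD.
have j0 : 0 < 2 ^+ j :> R by rewrite exprn_gt0.
have K1 : 1 <= 2 ^+ K :> R by rewrite exprn_ege1// ler1n.
rewrite ler_pdivlMr//; move: (2 ^+ j) (2 ^+ K) j0 K1 => A B A0 B1.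
rewrite (_ : A * (2 * (2 / (A * A * B))) * A = 4 / B); last by field; rewrite !lt0r_neq0// (lt_le_trans ltr01 B1).
by rewrite ler_pdivrMr ?(lt_le_trans ltr01 B1)// ler_peMr.
Qed.

(** The distribution functions of the densities [ev (S k)] converge uniformly
    to a continuous distribution function; integrals of waves against dF are
    limits of the corresponding coefficients, which are eventually constant. *)
Lemma limit_measure_exists : exists mu : probability (borel (circle R)) R,
  forall (m : int) (a : R[i]) (K : nat), (forall k, (K <= k)%N -> hat (S k) m = a) ->
    fourier mu m = a.
Proof.
have [P PF] := cdf_probability F_nd F_continuous F0 F1.
pose X : {mfun measurableTypeR R >-> borel (circle R)} := HB.pack cis_circle
  (isMeasurableFun.Build _ _ _ _ cis_circle measurable_cis_circle).
exists (distribution P X) => m a K ha.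
have [m1 m2] := cmeasurable_expz m.
have RintE (h : borel (circle R) -> R) : measurable_fun setT h -> (forall z, `|h z| <= 1) ->
    Rintegral (distribution P X) setT h = Rintegral P setT (h \o cis_circle).
  move=> mh h1; rewrite /Rintegral integral_distribution//; first exact/measurable_EFinP.
  apply: measurable_bounded_integrable => //.
  - exact: le_lt_trans (probability_le1 P measurableT) (ltry _).
  - by apply: measurableT_comp => //; exact: measurable_cis_circle.
  - by exists 1; split => // M M1 t _; exact: le_trans (h1 _) (ltW M1).
have n1 (z : borel (circle R)) : normc (sval z ^ m) = 1.
  by apply: complexI; apply: norm1_expz; exact/eqP/(svalP z).
rewrite /fourier /cintegral !RintE//; last 2 first.
- by move=> z; rewrite (le_trans (normr_Im_le _))// n1.
- by move=> z; rewrite (le_trans (normr_Re_le _))// n1.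
have ni : normc (- 'i : R[i]) <= 1.
  by rewrite normcN /= expr0n/= expr1n add0r sqrtr1.
have := integral_wave PF (_ : normc 1 <= 1) ha; rewrite normc1 => /(_ (lexx _)).
have := integral_wave PF ni ha.
have ReNi (z : R[i]) : Re (- 'i * z) = Im z.
  by case: z => x y /=; rewrite oppr0 mul0r mulN1r sub0r opprK.
rewrite ReNi (_ : (fun t => Re (- 'i * _)) = (fun t => Im (cis t ^ m))); last first.
  by apply/funext => t; rewrite ReNi.
rewrite mul1r (_ : (fun t => Re (1 * _)) = (fun t => Re (cis t ^ m))); last first.
  by apply/funext => t; rewrite mul1r.
by move=> hI hR; rewrite [X in X +i* _]hR [X in _ +i* X]hI; case: (a).
Qed.

End limit_measure.

(** * Trigonometric polynomials in L2 *)

Section energy.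
Context d (T : measurableType d) (R : realType).
Variable mu : {measure set T -> \bar R}.
Implicit Types f g : T -> R[i].

Lemma normc_ge0 (z : R[i]) : 0 <= normc z.
Proof. exact: le_trans (normr_ge0 _) (normr_Re_le z). Qed.

(** The square of the L_2 norm, as an integral that makes sense for every
    function. *)
Definition energy f : \bar R := (\int[mu]_x (normc (f x) ^+ 2)%:E)%E.

Lemma energy_Lnorm f :
  ('N[mu]_2[EFin \o (fun x => normc (f x))] `^ 2 = energy f)%E.
Proof.
rewrite poweR_Lnorm//; apply: eq_integral => x _ /=.
by rewrite ger0_norm ?normc_ge0// powR_mulrn// normc_ge0.
Qed.

Lemma energy_finite_norm f : (energy f < +oo)%E ->
  finite_norm mu 2 (fun x => normc (f x)).
Proof.
rewrite -energy_Lnorm /finite_norm => h; rewrite ltey; apply/eqP => E.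
by move: h; rewrite E poweRyr// ltxx.
Qed.

Lemma energy_square_integrable f : cmeasurable f -> (energy f < +oo)%E ->
  f \in square_integrable mu.
Proof. by move=> mf ef; apply/square_integrableP; split => //; exact: energy_finite_norm. Qed.

Lemma energy_L2norm (f : L2fun mu) :
  ((L2norm (\pi_(L2 mu) f)) ^+ 2)%:E = energy (val f).
Proof.
rewrite -energy_Lnorm -L2normE poweR_EFin powR_mulrn//.
by rewrite -lee_fin L2normE Lnorm_ge0.
Qed.

Lemma energy_lty (f : L2fun mu) : (energy (val f) < +oo)%E.
Proof. by rewrite -energy_L2norm ltry. Qed.

End energy.

Section trig_L2.
Variable R : realType.
Variable mu : probability (borel (circle R)) R.
Local Notation nu := (fourier mu).
Implicit Types p q : seq (R[i] * int).
Implicit Types z : borel (circle R).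

Definition evc p z := ev p (sval z).

Lemma norm_circle z : `|sval z| = 1.
Proof. exact/eqP/(svalP z). Qed.

Lemma cmeasurable_evc p : cmeasurable (evc p).
Proof.
elim: p => [|x p ih].
  rewrite (_ : evc _ = fun=> 0); first exact: cmeasurable_cst.
  by apply/funext => z; rewrite /evc /ev big_nil.
rewrite (_ : evc _ = (fun z => x.1 * sval z ^ x.2 + evc p z)).
  apply: cmeasurableD => //; apply: cmeasurableM; first exact: cmeasurable_cst.
  exact: cmeasurable_expz.
by apply/funext => z; rewrite /evc /ev big_cons.
Qed.

Lemma normc_evc_le p z : normc (evc p z) <= Re (l1norm p).
Proof.
have := le_ev_l1 p (norm_circle z); rewrite lecE /= => /andP[_]; exact.
Qed.

Lemma bounded_integrable (h : borel (circle R) -> R) (M : R) :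
  measurable_fun setT h -> (forall z, `|h z| <= M) -> mu.-integrable setT (EFin \o h).
Proof.
move=> mh hM; apply: measurable_bounded_integrable => //.
  exact: le_lt_trans (probability_le1 mu measurableT) (ltry _).
by exists M; split; rewrite ?num_real// => M' M1 t _; exact: le_trans (hM _) (ltW M1).
Qed.

Lemma integrable_evc p : mu.-integrable setT (EFin \o (fun z => Re (evc p z))) /\
  mu.-integrable setT (EFin \o (fun z => Im (evc p z))).
Proof.
have [m1 m2] := cmeasurable_evc p.
split; apply: (@bounded_integrable _ (Re (l1norm p))) => // z;
  apply: le_trans (normc_evc_le p z); [exact: normr_Re_le|exact: normr_Im_le].
Qed.

Lemma evc_cat p q z : evc (p ++ q) z = evc p z + evc q z.
Proof. exact: ev_cat. Qed.

Lemma cintegralD (f g : borel (circle R) -> R[i]) :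
  mu.-integrable setT (EFin \o (fun z => Re (f z))) ->
  mu.-integrable setT (EFin \o (fun z => Im (f z))) ->
  mu.-integrable setT (EFin \o (fun z => Re (g z))) ->
  mu.-integrable setT (EFin \o (fun z => Im (g z))) ->
  cintegral mu (fun z => f z + g z) = cintegral mu f + cintegral mu g.
Proof.
move=> f1 f2 g1 g2; apply/eqP; rewrite eq_complex/= -!RintegralD//.
by apply/andP; split; apply/eqP; apply: eq_Rintegral => z _; rewrite ?Defs.ReD ?Defs.ImD.
Qed.

Lemma cintegralZ (a : R[i]) (f : borel (circle R) -> R[i]) :
  mu.-integrable setT (EFin \o (fun z => Re (f z))) ->
  mu.-integrable setT (EFin \o (fun z => Im (f z))) ->
  cintegral mu (fun z => a * f z) = a * cintegral mu f.
Proof.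
move=> f1 f2; have iZ (r : R) (h : borel (circle R) -> R) :
    mu.-integrable setT (EFin \o h) -> mu.-integrable setT (EFin \o (fun z => r * h z)).
  by move=> hi; have := integrableZl measurableT r hi.
apply/eqP; rewrite eq_complex /cintegral Defs.ReM Defs.ImM/= -!RintegralZl// -RintegralB//; try exact: iZ.
rewrite -RintegralD//; try exact: iZ.
by apply/andP; split; apply/eqP; apply: eq_Rintegral => z _; rewrite ?Defs.ReM ?Defs.ImM.
Qed.

Lemma cintegral_evc p : cintegral mu (evc p) = pairing nu p.
Proof.
elim: p => [|x p ih].
  rewrite /pairing big_nil /cintegral (_ : evc _ = fun=> 0).
    by rewrite /= !Rintegral_cst// !mul0r.
  by apply/funext => z; rewrite /evc /ev big_nil.
rewrite /pairing big_cons -/(pairing _ _) -ih /fourier.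
have [i1 i2] := integrable_evc p.
have [j1 j2] := integrable_evc [:: (1, x.2)].
have [k1 k2] := integrable_evc [:: x].
have E1 : (fun z => sval z ^ x.2) = evc [:: (1, x.2)].
  by apply/funext => z; rewrite /evc ev_seq1 mul1r.
rewrite E1 -cintegralZ//.
rewrite (_ : (fun z => x.1 * _) = evc [:: x]); last first.
  by apply/funext => z; rewrite /evc ev_seq1 mul1r /ev big_seq1.
rewrite -cintegralD//; congr cintegral; apply/funext => z.
by rewrite /evc /ev big_cons big_seq1.
Qed.

Lemma pairing_conj p : pairing nu (tconj p) = (pairing nu p)^*.
Proof.
rewrite -!cintegral_evc /cintegral; have [i1 i2] := integrable_evc p.
have E z : evc (tconj p) z = (evc p z)^* by rewrite /evc ev_conj// norm_circle.
apply/eqP; rewrite eq_complex/= -[- \int[_]_x _]mulN1r -RintegralZl//.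
by apply/andP; split; apply/eqP; apply: eq_Rintegral => z _; rewrite E ?mulN1r; case: (evc p z).
Qed.

Lemma energy_evc p : energy mu (evc p) = (Re (sesq nu p p))%:E.
Proof.
have [i1 _] := integrable_evc (tmul p (tconj p)).
rewrite /sesq -cintegral_evc /cintegral/= /Rintegral fineK; last exact: integrable_fin_num.
apply: eq_integral => z _; congr EFin.
rewrite /evc ev_mul ?norm1_neq0 ?norm_circle// ev_conj ?norm_circle//.
by case: (ev p _) => x y; rewrite /= sqr_sqrtr ?addr_ge0 ?sqr_ge0// mulrN opprK -!expr2.
Qed.

Lemma evc_square_integrable p : evc p \in square_integrable mu.
Proof.
apply: energy_square_integrable; first exact: cmeasurable_evc.
by rewrite energy_evc ltry.
Qed.

Definition trigL2 p : L2 mu := \pi_(L2 mu) (Sub (evc p) (evc_square_integrable p)).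

Lemma trigL2_norm p : L2norm (trigL2 p) ^+ 2 = Re (sesq nu p p).
Proof. by apply: EFin_inj; rewrite energy_L2norm energy_evc. Qed.

Lemma trigL2_eq p q : (forall z, evc p z = evc q z) -> trigL2 p = trigL2 q.
Proof. by move=> pq; apply/L2_eqP; apply: nearW => z /=. Qed.

Lemma trigL2_cat p q : trigL2 (p ++ q) = trigL2 p + trigL2 q.
Proof.
by rewrite /trigL2 -pi_L2D; apply/L2_eqP; apply: nearW => z /=; rewrite evc_cat.
Qed.

Lemma trigL2_scale a p : trigL2 (tscale a p) = a *: trigL2 p.
Proof.
rewrite -[RHS]/(L2scale a _) pi_L2scale; apply/L2_eqP; apply: nearW => z /=.
by rewrite /evc ev_scale.
Qed.

Lemma mulz_trigL2 p : mulz mu (trigL2 p) = trigL2 (tmul [:: (1, 1)] p).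
Proof.
rewrite mulzE; apply/L2_eqP; apply: nearW => z /=.
by rewrite /evc ev_mul ?norm1_neq0 ?norm_circle// ev_seq1 mul1r expr1z.
Qed.

Lemma iter_mulz n : iter n (mulz mu) (trigL2 [:: (1, 0)]) = trigL2 [:: (1, n%:Z)].
Proof.
elim: n => [//|n ih]; rewrite iterS ih mulz_trigL2; apply: trigL2_eq => z.
rewrite /evc ev_mul ?norm1_neq0 ?norm_circle// !ev_seq1 !mul1r.
by rewrite -expfzDr ?norm1_neq0 ?norm_circle//; congr (_ ^ _); lia.
Qed.

End trig_L2.

(** * A Bessel inequality for bounded functionals *)

Section bessel.
Variable R : realType.
Variable mu : probability (borel (circle R)) R.
Local Notation nu := (fourier mu).
Implicit Types p q : seq (R[i] * int).

Lemma fourierN m : nu (- m) = (nu m)^*.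
Proof.
have := pairing_conj mu [:: (1, m)].
have -> : pairing nu [:: (1, m)] = nu m by rewrite /pairing big_seq1 mul1r.
suff -> : pairing nu (tconj [:: (1, m)]) = nu (- m) by [].
by rewrite /pairing big_seq1 -[LHS]/(1^* * nu (- m)) rmorph1 mul1r.
Qed.

Lemma L2norm_ge0 (v : L2 mu) : 0 <= L2norm v.
Proof. by have := normr_ge0 v; rewrite -[`|v|]/((L2norm v)%:C) lecR. Qed.

(** The measure has mass 1 and the l1-norm bounds the sup norm. *)
Lemma trigL2_norm_le p (M : R) : l1norm p <= M%:C -> L2norm (trigL2 mu p) <= M.
Proof.
move=> pM; have M0 : 0 <= M by rewrite -lecR (le_trans (l1_ge0 p)).
rewrite -(@ler_pXn2r _ 2) ?nnegrE ?L2norm_ge0// -lee_fin energy_L2norm /=.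
apply: (@le_trans _ _ (\int[mu]_z (M ^+ 2)%:E)%E); last first.
  by rewrite integral_cst// -[leRHS]mule1 lee_wpmul2l ?probability_le1// lee_fin exprn_ge0.
have [m1 m2] := cmeasurable_evc p.
apply: ge0_le_integral => //.
- by move=> z _; rewrite lee_fin exprn_ge0// normc_ge0.
- by apply/measurable_EFinP; apply: measurable_funX; apply: cmeasurable_normc; split.
move=> z _; rewrite lee_fin ler_pXn2r ?nnegrE ?normc_ge0//.
by apply: le_trans (normc_evc_le p z) _; move: pM; rewrite lecE => /andP[].
Qed.

Definition combination (a : nat -> R[i]) (u : nat -> seq (R[i] * int)) n :=
  flatten [seq tscale (a i) (u i) | i <- iota 0 n].

Lemma combinationS a u n :
  combination a u n.+1 = combination a u n ++ tscale (a n) (u n).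
Proof. by rewrite /combination -addn1 iotaD map_cat flatten_cat/= cats0. Qed.

Lemma sesq_combinationr a u n p : (forall i, (i < n)%N -> sesq nu p (u i) = 0) ->
  sesq nu p (combination a u n) = 0.
Proof.
elim: n => [|n ih] pu.
  by rewrite sesqE big1// => x _; rewrite big_nil.
rewrite combinationS sesq_catr sesq_scaler ih ?pu ?mulr0 ?addr0// => i ni.
by rewrite pu// ltnS ltnW.
Qed.

(** Pythagoras for a finite family of orthogonal polynomials. *)
Lemma sesq_combination a u n :
  (forall i j, (j < i)%N -> (i < n)%N -> sesq nu (u i) (u j) = 0) ->
  sesq nu (combination a u n) (combination a u n) =
  \sum_(i < n) (a i * (a i)^* * sesq nu (u i) (u i)).
Proof.
elim: n => [|n ih] orth.
  by rewrite big_ord0 sesqE /combination/= big_nil.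
rewrite big_ord_recr/= combinationS sesq_catl !sesq_catr ih; last first.
  by move=> i j ij ni; apply: orth => //; rewrite ltnS ltnW.
have nw : sesq nu (tscale (a n) (u n)) (combination a u n) = 0.
  by rewrite sesq_scalel sesq_combinationr ?mulr0// => i ni; apply: orth.
rewrite nw (sesq_herm _ _ fourierN) nw rmorph0 addr0 add0r.
by rewrite sesq_scalel sesq_scaler mulrA.
Qed.

Lemma trigL2_nil : trigL2 mu [::] = 0.
Proof. by apply: (addrI (trigL2 mu [::])); rewrite addr0 -trigL2_cat. Qed.

(** Apply [phi] to w, the sum of conj (phi u_i) u_i: then phi w is the sum S of
    the |phi u_i|^2, while |w|^2 <= S B^2 by orthogonality, so that
    S <= K B sqrt S. *)
Lemma bessel (phi : {linear L2 mu -> R[i]}) (K B : R) u n : 0 <= K ->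
  (forall v, normc (phi v) <= K * L2norm v) ->
  (forall i j, (j < i)%N -> (i < n)%N -> sesq nu (u i) (u j) = 0) ->
  (forall i, (i < n)%N -> L2norm (trigL2 mu (u i)) <= B) ->
  \sum_(i < n) normc (phi (trigL2 mu (u i))) ^+ 2 <= (K * B) ^+ 2.
Proof.
move=> K0 phiK orth uB; set S := \sum_(i < n) _.
have S0 : 0 <= S by apply: sumr_ge0 => i _; rewrite exprn_ge0// normc_ge0.
pose a i := (phi (trigL2 mu (u i)))^*.
pose w := trigL2 mu (combination a u n).
have sqr (z : R[i]) : z * z^* = (normc z ^+ 2)%:C.
  case: z => x y; rewrite /= sqr_sqrtr ?addr_ge0 ?sqr_ge0//.
  by apply/eqP; rewrite eq_complex /=; apply/andP; split; apply/eqP; ring.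
have phiw : phi w = S%:C.
  rewrite /w /S rmorph_sum/=; elim: (n) => [|k ih].
    by rewrite big_ord0 /combination/= trigL2_nil linear0.
  rewrite big_ord_recr/= -ih combinationS trigL2_cat trigL2_scale.
  by rewrite linearD linearZ/= /a -sqr; congr (_ + _); rewrite mulrC.
have wB : L2norm w ^+ 2 <= S * B ^+ 2.
  rewrite trigL2_norm sesq_combination// (big_morph _ (@Defs.ReD R) (erefl : Re 0 = 0)).
  rewrite mulr_suml; apply: ler_sum => i _.
  have -> : a i * (a i)^* = (normc (phi (trigL2 mu (u i))) ^+ 2)%:C.
    by rewrite -sqr mulrC; congr (_ * _); exact: conjcK.
  rewrite Defs.ReM/= mul0r subr0 ler_wpM2l ?exprn_ge0 ?normc_ge0//.
  rewrite -trigL2_norm lerXn2r ?nnegrE ?L2norm_ge0//; last exact: uB.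
  exact: le_trans (L2norm_ge0 _) (uB _ (ltn_ord i)).
have := phiK w; rewrite phiw.
have -> : normc S%:C = S by rewrite /= expr0n/= addr0 sqrtr_sqr ger0_norm.
move=> Sw; have [->|Sn0] := eqVneq S 0; first exact: sqr_ge0.
have Sp : 0 < S by rewrite lt_def Sn0.
rewrite -(ler_pM2l Sp); apply: (@le_trans _ _ ((K * L2norm w) ^+ 2)).
  by rewrite -expr2 lerXn2r ?nnegrE// mulr_ge0// L2norm_ge0.
by rewrite !exprMn [leRHS]mulrCA ler_wpM2l ?sqr_ge0.
Qed.

End bessel.

(** * Polynomials converging to a step function *)

Section threshold.
Variable R : realType.
Implicit Types (x y : R) (n m : nat).

Lemma bernoulli_le x n : -1 <= x -> 1 + n%:R * x <= (1 + x) ^+ n.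
Proof.
move=> x1; elim: n => [|n ih]; first by rewrite mul0r addr0 expr0.
have x10 : 0 <= 1 + x by rewrite -lerBlDl sub0r.
rewrite exprS; apply: le_trans (_ : _ <= (1 + x) * (1 + n%:R * x)) _; last first.
  by rewrite ler_wpM2l.
rewrite -natr1 -subr_ge0.
rewrite (_ : _ - _ = n%:R * x ^+ 2); last by ring.
by rewrite mulr_ge0// sqr_ge0.
Qed.

(** By the Bernoulli inequality the left-hand side is at most
    (1 - x)^n (1 + x)^n. *)
Lemma expr_one_sub_le x n : 0 <= x <= 1 -> (1 - x) ^+ n * (1 + n%:R * x) <= 1.
Proof.
move=> /andP[x0 x1].
apply: (@le_trans _ _ ((1 - x) ^+ n * (1 + x) ^+ n)).
  by rewrite ler_wpM2l ?exprn_ge0 ?subr_ge0// bernoulli_le// (le_trans _ x0)// lerN10.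
rewrite -exprMn -subr_sqr expr1n exprn_ile1// ?subr_ge0 ?expr_le1//.
by rewrite gerBl sqr_ge0.
Qed.

(** With x = s^2, the factor n s^n is bounded by the Bernoulli inequality and
    the remaining factor s^n tends to 0. *)
Lemma cvg_mulrn_expr x : 0 <= x < 1 -> (fun n => n%:R * x ^+ n) @ \oo --> (0 : R).
Proof.
move=> /andP[x0 x1]; have [->|xn0] := eqVneq x 0.
  apply: cvg_near_cst; exists 1%N => // n /= n0.
  by rewrite expr0n eqn0Ngt n0 mulr0.
have xp : 0 < x by rewrite lt_def xn0.
(* The factor n is absorbed by one of the two factors s^n of x^n. *)
pose s := Num.sqrt x; have s0 : 0 < s by rewrite sqrtr_gt0.
have s1 : s < 1 by rewrite -[1]sqrtr1 ltr_sqrt.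
have xs : x = s * s by rewrite -expr2 sqr_sqrtr// ltW.
pose t := s^-1 - 1; have t0 : 0 < t by rewrite subr_gt0 invf_gt1.
apply: (@squeeze_cvgr _ _ _ _ (fun=> 0) (fun n => t^-1 * s ^+ n)).
- apply: nearW => n; rewrite mulr_ge0 ?exprn_ge0//=.
  rewrite xs exprMn mulrA ler_wpM2r ?exprn_ge0 ?(ltW s0)//.
  have := @bernoulli_le t n; rewrite (le_trans _ (ltW t0)) ?lerN10// => /(_ isT).
  have E : 1 + t = s^-1 by rewrite /t addrC subrK.
  rewrite E => h; rewrite -[leRHS]mul1r ler_pdivlMr// mulrAC.
  rewrite -ler_pdivlMr ?exprn_gt0// mul1r -exprVn.
  by apply: le_trans h; rewrite lerDr.
- exact: cvg_cst.
- rewrite -[X in _ --> X](mulr0 t^-1); apply: cvgMr; apply: cvg_expr.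
  by rewrite ger0_norm ?ltW.
Qed.

(** Above 1/2 the number of factors 2^n n is large compared with y^(-n), so the
    power tends to 0; below 1/2 it is small compared with y^(-n), so the power
    tends to 1.  The factor n settles the case y = 1/2. *)
Lemma cvg_threshold y : 0 <= y <= 1 ->
  (fun n => 1 - (1 - y ^+ n) ^+ (2 ^ n * n)) @ \oo --> (if 2^-1 <= y then 1 else 0 : R).
Proof.
move=> /andP[y0 y1].
have yn n : 0 <= y ^+ n <= 1 by rewrite exprn_ge0// exprn_ile1.
have e0 n : 0 <= (1 - y ^+ n) ^+ (2 ^ n * n).
  by rewrite exprn_ge0// subr_ge0; case/andP: (yn n).
have [y2|y2] := lerP 2^-1 y.
- apply: (@squeeze_cvgr _ _ _ _ (fun n => 1 - n.+1%:R^-1) (fun=> 1)).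
  + apply: nearW => n; rewrite gerBl e0 andbT lerD2l lerN2.
    rewrite -[leRHS]mul1r ler_pdivlMr ?ltr0n//.
    apply: le_trans (expr_one_sub_le (2 ^ n * n) (yn n)); rewrite ler_wpM2l//.
    rewrite -nat1r lerD2l natrM mulrAC -[leLHS]mul1r ler_wpM2r//.
    by rewrite natrX -exprMn exprn_ege1// -ler_pdivrMl// mulr1.
  + rewrite -[X in _ --> X]subr0; apply: cvgB; first exact: cvg_cst.
    exact: cvg_harmonic.
  + exact: cvg_cst.
- apply: (@squeeze_cvgr _ _ _ _ (fun=> 0) (fun n => n%:R * (2 * y) ^+ n)).
  + apply: nearW => n; rewrite subr_ge0 exprn_ile1 ?subr_ge0 ?gerBl; last 2 first.
      by case/andP: (yn n).
      by case/andP: (yn n).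
    have := @bernoulli_le (- y ^+ n) (2 ^ n * n); rewrite lerN2.
    case/andP: (yn n) => _ -> /(_ isT) h; rewrite lerBlDl -lerBlDr.
    apply: le_trans h; rewrite natrM natrX exprMn mulrN.
    by rewrite le_eqVlt; apply/orP; left; apply/eqP; ring.
  + exact: cvg_cst.
  + apply: cvg_mulrn_expr; rewrite mulr_ge0//=.
    by rewrite -ltr_pdivlMl// mulr1.
Qed.

End threshold.

(** * Density of trigonometric polynomials in L2 *)

Section density.
Variable R : realType.
Variable mu : probability (borel (circle R)) R.
Implicit Types (f g : borel (circle R) -> R[i]) (p q : seq (R[i] * int)).
Local Notation energy := (energy mu).

(** Membership in the L_2 closure of the trigonometric polynomials, for
    functions rather than for classes modulo almost everywhere equality. *)
Definition trig_approx f := cmeasurable f /\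
  forall e : R, 0 < e -> exists p, (energy (fun z => (f z - evc p z)%R) < e%:E)%E.

Lemma measurable_energy f : cmeasurable f ->
  measurable_fun setT (fun z => (normc (f z) ^+ 2)%:E).
Proof.
by move=> /cmeasurable_normc mf; apply/measurable_EFinP; exact: measurable_funX.
Qed.

Lemma cmeasurableB f g : cmeasurable f -> cmeasurable g ->
  cmeasurable (fun z => f z - g z).
Proof.
move=> mf mg; rewrite (_ : (fun _ => _) = (fun z => f z + (-1) * g z)).
  by apply: cmeasurableD => //; apply: cmeasurableM => //; exact: cmeasurable_cst.
by apply/funext => z; rewrite mulN1r.
Qed.

Lemma energy_le f g (a : R) : cmeasurable f -> cmeasurable g ->
  (forall z, normc (f z) <= a * normc (g z)) -> (energy f <= (a ^+ 2)%:E * energy g)%E.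
Proof.
move=> mf mg fg; rewrite /energy -ge0_integralZl//=; first last.
- by rewrite lee_fin sqr_ge0.
- by move=> z _; rewrite lee_fin sqr_ge0.
- exact: measurable_energy.
apply: ge0_le_integral => //.
- by move=> z _; rewrite lee_fin sqr_ge0.
- exact: measurable_energy.
- by apply: measurable_funeM; exact: measurable_energy.
move=> z _; rewrite -EFinM lee_fin -exprMn lerXn2r ?nnegrE ?normc_ge0//.
exact: le_trans (normc_ge0 _) (fg z).
Qed.

Lemma energyD f g : cmeasurable f -> cmeasurable g ->
  (energy (fun z => (f z + g z)%R) <= 2%:E * energy f + 2%:E * energy g)%E.
Proof.
move=> mf mg; rewrite /energy -!ge0_integralZl//=; try exact: measurable_energy;
  try by move=> z _; rewrite lee_fin sqr_ge0.
rewrite -ge0_integralD//=; try by [apply: measurable_funeM; exact: measurable_energy |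
  move=> z _; rewrite -EFinM lee_fin mulr_ge0// sqr_ge0].
apply: ge0_le_integral => //.
- by move=> z _; rewrite lee_fin sqr_ge0.
- by apply: measurable_energy; exact: cmeasurableD.
- by apply: emeasurable_funD; apply: measurable_funeM; exact: measurable_energy.
move=> z _; rewrite -!EFinM -EFinD lee_fin.
have h : normc (f z + g z) <= normc (f z) + normc (g z) := le_normcD _ _.
apply: (@le_trans _ _ ((normc (f z) + normc (g z)) ^+ 2)).
  by rewrite lerXn2r ?nnegrE ?addr_ge0 ?normc_ge0.
rewrite -subr_ge0 (_ : _ - _ = (normc (f z) - normc (g z)) ^+ 2) ?sqr_ge0//.
by ring.
Qed.

Lemma trig_approx_evc p : trig_approx (evc p).
Proof.
split; first exact: cmeasurable_evc.
move=> e e0; exists p; rewrite (_ : energy _ = 0%E) ?lte_fin//.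
by rewrite /energy integral0_eq// => z _; rewrite subrr normc0 expr0n.
Qed.

Lemma trig_approx_closed f : cmeasurable f ->
  (forall e : R, 0 < e -> exists2 g, trig_approx g & (energy (fun z => (f z - g z)%R) < e%:E)%E) ->
  trig_approx f.
Proof.
move=> mf fg; split => // e e0; have e4 : 0 < e / 4 by rewrite divr_gt0.
have [g [mg /(_ _ e4)[p gp] fge]] := fg _ e4; exists p.
have mp := cmeasurable_evc p.
apply: (@le_lt_trans _ _ (2%:E * energy (fun z => (f z - g z)%R) + 2%:E * energy (fun z => (g z - evc p z)%R))%E).
  rewrite [X in (energy X <= _)%E](_ : _ = (fun z => (f z - g z) + (g z - evc p z))).
    by apply: energyD; exact: cmeasurableB.
  by apply/funext => z; rewrite addrA subrK.
rewrite (_ : e%:E = 2%:E * (e / 4)%:E + 2%:E * (e / 4)%:E)%E; last first.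
  by rewrite -!EFinM -EFinD; congr EFin; field.
by rewrite lteD// lte_pmul2l.
Qed.

Lemma trig_approxD f g : trig_approx f -> trig_approx g ->
  trig_approx (fun z => f z + g z).
Proof.
move=> [mf fp] [mg gq]; split; first exact: cmeasurableD.
move=> e e0; have e4 : 0 < e / 4 by rewrite divr_gt0.
have [p fpe] := fp _ e4; have [q gqe] := gq _ e4; exists (p ++ q).
have mp := cmeasurable_evc p; have mq := cmeasurable_evc q.
apply: (@le_lt_trans _ _ (2%:E * energy (fun z => (f z - evc p z)%R) + 2%:E * energy (fun z => (g z - evc q z)%R))%E).
  rewrite [X in (energy X <= _)%E](_ : _ = (fun z => (f z - evc p z) + (g z - evc q z))).
    by apply: energyD; exact: cmeasurableB.
  by apply/funext => z; rewrite evc_cat addrACA -opprD.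
rewrite (_ : e%:E = 2%:E * (e / 4)%:E + 2%:E * (e / 4)%:E)%E; last first.
  by rewrite -!EFinM -EFinD; congr EFin; field.
by rewrite lteD// lte_pmul2l.
Qed.

(** Multiplication by a bounded function is continuous in L_2, so it is enough
    that the products with trigonometric polynomials are in the closure. *)
Lemma trig_approxMl f g (M : R) : trig_approx f -> cmeasurable g ->
  (forall z, normc (g z) <= M) -> (forall p, trig_approx (fun z => g z * evc p z)) ->
  trig_approx (fun z => g z * f z).
Proof.
move=> [mf fp] mg gM gp; apply: trig_approx_closed; first exact: cmeasurableM.
have M0 : 0 <= M := le_trans (normc_ge0 _) (gM (circle1 R)).
move=> e e0; have M1 : 0 < M ^+ 2 + 1 by rewrite ltr_wpDl ?sqr_ge0.
have [p fpe] := fp _ (divr_gt0 e0 M1); exists (fun z => g z * evc p z) => //.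
have mp := cmeasurable_evc p.
apply: le_lt_trans (energy_le (g := fun z => f z - evc p z) (a := M) _ _ _) _ => //.
- by apply: cmeasurableB; exact: cmeasurableM.
- exact: cmeasurableB.
- by move=> z; rewrite -mulrBr normcM ler_wpM2r ?normc_ge0.
apply: (@le_lt_trans _ _ ((M ^+ 2)%:E * (e / (M ^+ 2 + 1))%:E)%E).
  by rewrite lee_wpmul2l ?lee_fin ?sqr_ge0// ltW.
by rewrite -EFinM lte_fin mulrCA gtr_pMr// ltr_pdivrMr// mul1r ltrDl.
Qed.

Lemma evc_tmul p q z : evc (tmul p q) z = evc p z * evc q z.
Proof. by rewrite /evc ev_mul// norm1_neq0// norm_circle. Qed.

(** The bounded functions in the closure form an algebra: [trig_approxMl] is
    used twice, the second time with a polynomial as bounded factor. *)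
Lemma trig_approxM f g (M : R) : trig_approx f -> trig_approx g ->
  (forall z, normc (g z) <= M) -> trig_approx (fun z => g z * f z).
Proof.
move=> fa ga gM; apply: (trig_approxMl fa (proj1 ga) gM) => p.
rewrite (_ : (fun _ => _) = (fun z => evc p z * g z)); last first.
  by apply/funext => z; rewrite mulrC.
apply: (trig_approxMl ga (cmeasurable_evc p) (@normc_evc_le _ p)) => q.
rewrite (_ : (fun _ => _) = evc (tmul p q)); first exact: trig_approx_evc.
by apply/funext => z; rewrite evc_tmul.
Qed.

Lemma evc_cst (a : R[i]) (z : borel (circle R)) : evc [:: (a, 0)] z = a.
Proof. by rewrite /evc ev_seq1 expr0z mulr1. Qed.

Lemma trig_approx_cst (a : R[i]) : trig_approx (fun=> a).
Proof.
rewrite (_ : (fun=> a) = evc [:: (a, 0)]); first exact: trig_approx_evc.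
by apply/funext => z; rewrite evc_cst.
Qed.

Lemma trig_approxZ (a : R[i]) f : trig_approx f -> trig_approx (fun z => a * f z).
Proof.
move=> fa; apply: (trig_approxM (M := normc a) fa (trig_approx_cst a)) => z.
exact: lexx.
Qed.

Lemma trig_approxB f g : trig_approx f -> trig_approx g ->
  trig_approx (fun z => f z - g z).
Proof.
move=> fa ga; rewrite (_ : (fun _ => _) = (fun z => f z + (-1) * g z)).
  by apply: trig_approxD => //; exact: trig_approxZ.
by apply/funext => z; rewrite mulN1r.
Qed.

(** Dominated convergence of the squared distances. *)
Lemma trig_approx_lim (f_ : nat -> borel (circle R) -> R[i]) f (h : borel (circle R) -> R) :
  cmeasurable f -> (forall n, trig_approx (f_ n)) ->
  (forall z, (fun n => normc (f z - f_ n z)) @ \oo --> (0 : R)) ->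
  mu.-integrable setT (EFin \o h) ->
  (forall n z, normc (f z - f_ n z) ^+ 2 <= h z) -> trig_approx f.
Proof.
move=> mf fa ff hi fh; apply: trig_approx_closed => // e e0.
have [_ _ cv] : [/\ mu.-integrable setT (fun _ : borel (circle R) => 0%E),
   [sequence \int[mu]_(x in setT) `|(normc (f x - f_ n x) ^+ 2)%:E - 0|]_n%E @ \oo --> 0%E &
   [sequence \int[mu]_(x in setT) (normc (f x - f_ n x) ^+ 2)%:E]_n%E @ \oo --> (\int[mu]_(x in setT) 0)%E].
  apply: (@dominated_convergence _ _ _ mu setT measurableT _ (fun=> 0%E) (EFin \o h)) => //.
  - move=> n; apply: (@measurable_energy (fun x => f x - f_ n x)).
    by apply: cmeasurableB => //; have [] := fa n.
  - apply: aeW => z _; apply/cvg_EFin; first exact: nearW.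
    have c : (fun n => normc (f z - f_ n z) * normc (f z - f_ n z)) @ \oo --> (0 * 0 : R).
      by apply: cvgM; exact: ff.
    by rewrite mulr0 in c; exact: c.
  - have H z n : [set: borel (circle R)] z -> (`|(normc (f z - f_ n z) ^+ 2)%:E| <= (EFin \o h) z)%E.
      by move=> _; rewrite /= lee_fin ger0_norm ?sqr_ge0.
    exact: (aeW mu H).
have [n nP] : exists n, (energy (fun z => (f z - f_ n z)%R) < e%:E)%E.
  move: cv; rewrite integral0 => /fine_cvgP[[n1 _ fin] /cvgr_lt/(_ _ e0)[n2 _ lt_e]].
  exists (maxn n1 n2); have := lt_e _ (leq_maxr n1 n2); rewrite -lte_fin /=.
  by rewrite fineK//; apply: (fin _ (leq_maxl n1 n2)).
by exists (f_ n).
Qed.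

Lemma trig_approx_blim (f_ : nat -> borel (circle R) -> R[i]) f (M : R) :
  cmeasurable f -> (forall n, trig_approx (f_ n)) ->
  (forall z, (fun n => normc (f z - f_ n z)) @ \oo --> (0 : R)) ->
  (forall n z, normc (f z - f_ n z) <= M) -> trig_approx f.
Proof.
move=> mf fa ff fM; apply: (trig_approx_lim (h := fun=> M ^+ 2) mf fa ff).
  exact/finite_measure_integrable_cst.
move=> n z; rewrite lerXn2r ?nnegrE ?normc_ge0//.
exact: le_trans (normc_ge0 _) (fM n z).
Qed.

Definition cindic (A : set (borel (circle R))) z : R[i] := (\1_A z)%:C.

(** These sets form a sigma-algebra because the closure contains the constants
    and is stable under differences, products of bounded functions and bounded
    limits. *)
Definition trig_set (A : set (borel (circle R))) := trig_approx (cindic A).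

Lemma cmeasurable_cindic A : measurable A -> cmeasurable (cindic A).
Proof. by move=> mA; split; [exact: measurable_indic|exact: measurable_cst]. Qed.

Lemma normc_real (x : R) : normc x%:C = `|x|.
Proof. by rewrite /= expr0n/= addr0 sqrtr_sqr. Qed.

Lemma normc_cindic_le A z : normc (cindic A z) <= 1.
Proof. by rewrite normc_real indicE; case: (_ \in _); rewrite ?normr1 ?normr0. Qed.

Lemma trig_set0 : trig_set set0.
Proof.
rewrite /trig_set (_ : cindic _ = fun=> 0); first exact: trig_approx_cst.
by apply/funext => z; rewrite /cindic indic0.
Qed.

Lemma trig_setC A : trig_set A -> trig_set (~` A).
Proof.
move=> tA; rewrite /trig_set (_ : cindic _ = fun z => 1 - cindic A z).
  by apply: trig_approxB => //; exact: trig_approx_cst.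
by apply/funext => z; rewrite /cindic !indicE in_setC; case: (_ \in _);
    rewrite rmorph0 rmorph1 ?subrr ?subr0.
Qed.

Lemma trig_setI A B : trig_set A -> trig_set B -> trig_set (A `&` B).
Proof.
move=> tA tB; rewrite /trig_set (_ : cindic _ = fun z => cindic B z * cindic A z).
  by apply: (trig_approxM (M := 1)) => // z; exact: normc_cindic_le.
by apply/funext => z; rewrite /cindic -rmorphM/= !indicE in_setI -mulnb natrM mulrC.
Qed.

Lemma trig_setU A B : trig_set A -> trig_set B -> trig_set (A `|` B).
Proof.
move=> tA tB; rewrite -[_ `|` _]setCK setCU.
by apply: trig_setC; apply: trig_setI; exact: trig_setC.
Qed.

Lemma trig_set_measurable A : trig_set A -> measurable A.
Proof.
move=> [[+ _] _]; rewrite (_ : (fun _ => _) = \1_A :> (_ -> R)) => // mA.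
rewrite -(_ : \1_A @^-1` [set (1 : R)] = A); last first.
  apply/seteqP; split => z /=; rewrite indicE; first by case: (boolP (_ \in _)) => [/set_mem//|_ /esym/eqP]; rewrite oner_eq0.
  by move=> /mem_set ->.
by rewrite -[X in measurable X]setTI; apply: mA.
Qed.

Lemma trig_set_bigcup (F : (set (borel (circle R)))^nat) :
  (forall n, trig_set (F n)) -> trig_set (\bigcup_n F n).
Proof.
move=> tF; pose G n := \bigcup_(i < n) F i.
have tG n : trig_set (G n).
  elim: n => [|n ih]; first by rewrite /G bigcup_mkord big_ord0; exact: trig_set0.
  by rewrite /G bigcup_mkord big_ord_recr/= -bigcup_mkord; exact: trig_setU.
have mU : measurable (\bigcup_n F n).
  by apply: bigcupT_measurable => n; exact: trig_set_measurable.
apply: (trig_approx_blim (f_ := fun n => cindic (G n)) (M := 1) _ tG).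
- exact: cmeasurable_cindic.
- move=> z; apply: cvg_near_cst; rewrite /cindic.
  have [[n _ Fz]|nF] := pselect ((\bigcup_n F n) z).
    exists n.+1 => // m nm.
    have -> : \1_(G m) z = 1 :> R by rewrite indicE mem_set//; exists n.
    have -> : \1_(\bigcup_n F n) z = 1 :> R by rewrite indicE mem_set//; exists n.
    by rewrite -rmorphB subrr normc_real normr0.
  exists 0%N => // m _.
  have -> : \1_(G m) z = 0 :> R.
    by rewrite indicE memNset// => -[n _ Fz]; apply: nF; exists n.
  have -> : \1_(\bigcup_n F n) z = 0 :> R by rewrite indicE memNset.
  by rewrite -rmorphB subrr normc_real normr0.
- move=> n z; rewrite /cindic -rmorphB normc_real !indicE.
  by case: (_ \in _); case: (_ \in _); rewrite ?subrr ?subr0 ?sub0r ?normrN ?normr0 ?normr1.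
Qed.

(** The affine function y is a trigonometric polynomial on the circle, with
    values in [0, 1], that crosses 1/2 on the boundary line of the half-plane;
    the polynomials of [cvg_threshold] in y converge to the indicator. *)
Lemma trig_set_halfplane (q : R[i]) (a : R) :
  trig_set [set z | a <= Re (sval z * q^*)].
Proof.
(* M is chosen so that |Re (z conj q) - a| <= M on the circle. *)
pose M := normc q + `|a| + 1; have M0 : 0 < M.
  by rewrite ltr_wpDl// addr_ge0// normc_ge0.
pose y (z : borel (circle R)) := 2^-1 + (Re (sval z * q^*) - a) / (2 * M) : R.
have bnd (z : borel (circle R)) : `|Re (sval z * q^*)| <= normc q.
  apply: le_trans (normr_Re_le _) _; rewrite normcM.
  rewrite (_ : normc (sval z) = 1); last exact: normc_circle.
  by rewrite mul1r; case: (q) => u v /=; rewrite sqrrN.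
have y01 (z : borel (circle R)) : 0 <= y z <= 1.
  have := bnd z; have := ler_norm a; have := ler_norm (- a); rewrite normrN ler_norml => a1 a2 /andP[b1 b2].
  have : `|(Re (sval z * q^*) - a) / (2 * M)| <= 2^-1.
    rewrite normrM normfV (gtr0_norm (_ : 0 < 2 * M)) ?mulr_gt0//.
    rewrite ler_pdivrMr ?mulr_gt0// mulKf// ler_norml /M.
    by apply/andP; split; lra.
  by rewrite ler_norml /y => /andP[? ?]; apply/andP; split; lra.
have ty : trig_approx (fun z => (y z)%:C).
  pose u : R[i] := ((2 * M)^-1 / 2)%:C.
  rewrite (_ : (fun _ => _) = evc [:: ((2^-1 - a / (2 * M))%:C, 0); (u * q^*, 1); (u * q, -1)]).
    exact: trig_approx_evc.
  apply/funext => z; rewrite /evc /ev !big_cons big_nil expr0z mulr1 addr0 expr1z exprN1/=.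
  rewrite -norm1_conj ?norm_circle// /y /u; move: (sval z) => [x1 x2]; case: (q) => q1 q2.
  have M2 : M != 0 by exact: lt0r_neq0.
  apply/eqP; rewrite eq_complex /=; apply/andP; split; apply/eqP; field; exact: M2.
pose f_ n z : R[i] := (1 - (1 - y z ^+ n) ^+ (2 ^ n * n))%:C.
have tX (h : borel (circle R) -> R) n : (forall z, 0 <= h z <= 1) -> trig_approx (fun z => (h z)%:C) ->
    trig_approx (fun z => (h z ^+ n)%:C).
  move=> h01 th; elim: n => [|n ih]; first exact: (trig_approx_cst 1).
  rewrite (_ : (fun _ => _) = (fun z => (h z)%:C * (h z ^+ n)%:C)).
    apply: (trig_approxM (M := 1)) => [||z]; [exact: ih|exact: th|rewrite normc_real].
    by have /andP[h0 h1] := h01 z; rewrite ger0_norm.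
  by apply/funext => z; rewrite -rmorphM/= exprS.
have X01 (h : R) n : 0 <= h <= 1 -> 0 <= h ^+ n <= 1.
  by move=> /andP[h0 h1]; rewrite exprn_ge0// exprn_ile1.
have C01 (h : R) : 0 <= h <= 1 -> 0 <= 1 - h <= 1.
  by move=> /andP[h0 h1]; rewrite subr_ge0 h1 gerBl.
have tC (h : borel (circle R) -> R) : trig_approx (fun z => (h z)%:C) ->
    trig_approx (fun z => (1 - h z)%:C).
  move=> th; rewrite (_ : (fun _ => _) = (fun z => 1 - (h z)%:C)).
    by apply: trig_approxB => //; exact: trig_approx_cst.
  by apply/funext => z; rewrite rmorphB.
have tf n : trig_approx (f_ n).
  apply: (tC (fun z => (1 - y z ^+ n) ^+ (2 ^ n * n))).
  apply: (tX (fun z => 1 - y z ^+ n)); first by move=> z; exact/C01/X01.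
  by apply: tC; exact: tX.
set A := [set _ | _].
have AE z : \1_A z = (if 2^-1 <= y z then 1 else 0 : R).
  have -> : (2^-1 <= y z) = (a <= Re (sval z * q^*)).
    by rewrite /y lerDl pmulr_lge0 ?invr_gt0 ?mulr_gt0// subr_ge0.
  rewrite indicE; case: ifPn => h; first by rewrite mem_set.
  by rewrite memNset//; exact/negP.
have cv z : (fun n => 1 - (1 - y z ^+ n) ^+ (2 ^ n * n)) @ \oo --> (\1_A z : R).
  by rewrite AE; exact: cvg_threshold.
apply: (trig_approx_blim (f_ := f_) (M := 1)) => //.
- split; last exact: measurable_cst.
  have := @measurable_fun_cvg _ _ _ setT (fun n z => Re (f_ n z)) (\1_A).
  apply => //.
    by move=> n; have [[+ _] _] := tf n.
  by move=> z _; exact: cv.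
- move=> z; rewrite /cindic /f_.
  rewrite (_ : (fun n => _) = (fun n => `|\1_A z - (1 - (1 - y z ^+ n) ^+ (2 ^ n * n))|)); last first.
    by apply/funext => n; rewrite -rmorphB normc_real.
  rewrite -(@normr0 _ R) -[X in `|X|](subrr (\1_A z : R)).
  by apply: cvg_norm; apply: cvgB; [exact: cvg_cst|exact: cv].
- move=> n z; rewrite /cindic /f_ -rmorphB normc_real AE.
  have /andP[g0 g1] := C01 _ (X01 _ (2 ^ n * n)%N (C01 _ (X01 _ n (y01 z)))).
  by rewrite ler_norml; case: ifP => _; apply/andP; split; lra.
Qed.

Lemma rat_close (x e : R) : 0 < e -> exists r : rat, `|x - ratr r| < e.
Proof.
move=> e0; have xe : x - e < x + e by rewrite ltrD2l gtrN.
have [r] := rat_in_itvoo xe.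
by rewrite in_itv/= => /andP[? ?]; exists r; rewrite ltr_norml; apply/andP; split; lra.
Qed.

(** On the unit circle |z - q|^2 = 1 + |q|^2 - 2 Re (z conj q), so a disc cuts
    the circle in the same arc as a half-plane. *)
Definition disc_bound (q : R[i]) (r : R) : R := (1 + normc q ^+ 2 - r ^+ 2) / 2.

Lemma circle_disc (q : R[i]) (r : R) (z : circle R) : 0 <= r ->
  (disc_bound q r <= Re (sval z * q^*)) = (normc (sval z - q) <= r).
Proof.
move=> r0; rewrite -[RHS](@ler_pXn2r _ 2) ?nnegrE ?normc_ge0//.
have := normc_circle z; move: (sval z) => [x y] /=; rewrite /disc_bound.
case: q => u v /=; rewrite !sqr_sqrtr ?addr_ge0 ?sqr_ge0// => xy.
have : x ^+ 2 + y ^+ 2 = 1.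
  by rewrite -[LHS]sqr_sqrtr ?addr_ge0 ?sqr_ge0// xy expr1n.
move=> {}xy; rewrite ler_pdivrMr//.
rewrite -[LHS]subr_ge0 -[RHS]subr_ge0; apply: (congr1 (fun t => 0 <= t)).
rewrite (_ : (x - u) ^+ 2 + (y - v) ^+ 2 = (x ^+ 2 + y ^+ 2) + (u ^+ 2 + v ^+ 2) - (x * u + y * v) * 2); last by ring.
by rewrite xy; ring.
Qed.

(** An open set is the countable union of the arcs cut by the discs with
    rational centre and radius that it contains. *)
Lemma trig_set_open (U : set (circle R)) : open U -> trig_set U.
Proof.
move=> [W oW WU].
pose H (c : rat * rat * rat) : set (borel (circle R)) :=
  let q := ratr c.1.1 +i* ratr c.1.2 : R[i] in
  [set z | disc_bound q (ratr c.2) <= Re (sval z * q^*)].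
pose F n : set (borel (circle R)) := if unpickle n is Some c then
  if `[< H c `<=` U >] then H c else set0 else set0.
suff -> : U = \bigcup_n F n.
  apply: trig_set_bigcup => n; rewrite /F; case: unpickle => [c|]; last exact: trig_set0.
  by case: ifP => _; [exact: trig_set_halfplane|exact: trig_set0].
apply/seteqP; split => z; last first.
  move=> [n _]; rewrite /F; case: unpickle => [c|//].
  by case: asboolP => // HU /HU.
rewrite -WU /= => Wz.
have : nbhs (sval z : R[i]^o) W by exact: open_nbhs_nbhs.
move=> /nbhs_ballP[e /= e0 zeW].
have eE : e = (Re e)%:C by rewrite RRe_real// gtr0_real.
have {}e0 : 0 < Re e by rewrite -ltcR -eE.
have e4 : 0 < Re e / 4 by lra.
(* A rational radius between 0 and Re e / 2, then a centre within that radius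
   of z: the disc contains z and stays in the ball of radius e. *)
have [r] := rat_close (Re e / 4) e4.
rewrite ltr_norml => /andP[r1 r2].
have r0 : 0 < ratr r :> R by lra.
have r2' : 0 < ratr r / 2 :> R by lra.
have [a az] := rat_close (Re (sval z)) r2'.
have [b bz] := rat_close (Im (sval z)) r2'.
pose q : R[i] := ratr a +i* ratr b.
have zq : normc (sval z - q) <= ratr r.
  apply: le_trans (normc_le_ReIm _) _; rewrite [leRHS]splitr.
  by rewrite Defs.ReD Defs.ImD; exact: lerD (ltW az) (ltW bz).
have rr : ratr r + ratr r < Re e by lra.
exists (pickle (a, b, r)); first exact: I.
rewrite /F pickleK.
have HU : H (a, b, r) `<=` U.
  move=> w; rewrite /H /= circle_disc ?(ltW r0)// => wq; rewrite -WU; apply: zeW.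
  rewrite -ball_normE /= eE ltcR.
  have -> : sval z - sval w = (sval z - q) - (sval w - q) by ring.
  apply: le_lt_trans (le_normcD _ _) _; rewrite normcN.
  exact: le_lt_trans (lerD zq wq) rr.
by rewrite asboolT// /H /= circle_disc// ltW.
Qed.

Lemma trig_set_all A : measurable A -> trig_set A.
Proof.
apply: smallest_sub; last exact: trig_set_open.
split; [exact: trig_set0|by move=> B; rewrite setTD; exact: trig_setC|].
exact: trig_set_bigcup.
Qed.

Lemma trig_approx_sum (I : Type) (r : seq I) (F : I -> borel (circle R) -> R[i]) :
  (forall i, trig_approx (F i)) -> trig_approx (fun z => \sum_(i <- r) F i z).
Proof.
move=> tF; elim: r => [|i r ih].
  rewrite (_ : (fun _ => _) = fun=> 0); first exact: trig_approx_cst.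
  by apply/funext => z; rewrite big_nil.
rewrite (_ : (fun _ => _) = fun z => F i z + \sum_(j <- r) F j z).
  exact: trig_approxD.
by apply/funext => z; rewrite big_cons.
Qed.

Import HBNNSimple.

Lemma trig_approx_nnsfun (h : {nnsfun (borel (circle R)) >-> R}) :
  trig_approx (fun z => (h z)%:C).
Proof.
pose r : seq R := finmap.enum_fset (fset_set (range h)).
rewrite (_ : (fun _ => _) =
    (fun z => \sum_(y <- r) y%:C * cindic (h @^-1` [set y]) z)).
  by apply: trig_approx_sum => y; apply: trig_approxZ; exact: trig_set_all.
apply/funext => z; rewrite fimfunE fsbig_finite// rmorph_sum.
by apply: eq_bigr => i _; rewrite rmorphM.
Qed.

Lemma trig_approx_nneg (h : borel (circle R) -> R) : measurable_fun setT h ->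
  (forall z, 0 <= h z) -> (\int[mu]_z ((h z) ^+ 2)%:E < +oo)%E ->
  trig_approx (fun z => (h z)%:C).
Proof.
move=> mh h0 hoo; have mhE : measurable_fun setT (EFin \o h) by exact/measurable_EFinP.
pose g := nnsfun_approx measurableT mhE.
have cv z : (fun n => g n z) @ \oo --> h z.
  have := @cvg_nnsfun_approx _ _ _ _ measurableT _ mhE (fun z _ => h0 z) z I.
  by move=> /fine_cvgP[_].
have gh n z : 0 <= g n z <= h z.
  apply/andP; split; first exact: fun_ge0.
  have gnd : nondecreasing_seq (fun n => g n z).
    by move=> m k mk; have /lefP := nd_nnsfun_approx measurableT mhE mk; apply.
  rewrite -(cvg_lim (@Rhausdorff R) (cv z)).
  by apply: nondecreasing_cvgn_le => //; apply/cvg_ex; exists (h z); exact: cv.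
have mh2 : measurable_fun setT (fun z => (h z) ^+ 2) by exact: measurable_funX.
apply: (trig_approx_lim (f_ := fun n z => (g n z)%:C) (h := fun z => h z ^+ 2)).
- by split => //; exact: measurable_cst.
- by move=> n; exact: trig_approx_nnsfun.
- move=> z; rewrite (_ : (fun n => _) = (fun n => `|h z - g n z|)); last first.
    by apply/funext => n; rewrite -rmorphB normc_real.
  rewrite -(@normr0 _ R) -[X in `|X|](subrr (h z : R)).
  by apply: cvg_norm; apply: cvgB; [exact: cvg_cst|exact: cv].
- apply/integrableP; split; first exact/measurable_EFinP.
  by under eq_integral do rewrite /= ger0_norm ?sqr_ge0//.
- move=> n z; rewrite -rmorphB normc_real; have /andP[g0 gl] := gh n z.
  by rewrite lerXn2r ?nnegrE// ger0_norm ?subr_ge0// gerBl.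
Qed.

Lemma trig_approx_real (h : borel (circle R) -> R) : measurable_fun setT h ->
  (\int[mu]_z ((h z) ^+ 2)%:E < +oo)%E -> trig_approx (fun z => (h z)%:C).
Proof.
move=> mh hoo.
have part (k : borel (circle R) -> R) : measurable_fun setT k ->
    (forall z, 0 <= k z) -> (forall z, k z <= `|h z|) -> trig_approx (fun z => (k z)%:C).
  move=> mk k0 kh; apply: trig_approx_nneg => //; apply: le_lt_trans hoo.
  apply: ge0_le_integral => //.
  - by move=> z _; rewrite lee_fin sqr_ge0.
  - by apply/measurable_EFinP; exact: measurable_funX.
  - by apply/measurable_EFinP; exact: measurable_funX.
  move=> z _; rewrite lee_fin -[leRHS]real_normK ?num_real//.
  by rewrite lerXn2r ?nnegrE.
rewrite (_ : (fun _ => _) = (fun z => (h^\+ z)%:C - (h^\- z)%:C)).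
  apply: trig_approxB; apply: part => [|z|z].
  - exact: measurable_funrpos.
  - exact: funrpos_ge0.
  - by rewrite /funrpos; case: (lerP (h z) 0) => h0; rewrite ?normr_ge0 ?ler_norm.
  - exact: measurable_funrneg.
  - exact: funrneg_ge0.
  - rewrite /funrneg -[leRHS]normrN.
    by case: (lerP (- h z) 0) => h0; rewrite ?normr_ge0 ?ler_norm.
apply/funext => z; rewrite -rmorphB; congr (_%:C).
by rewrite -{1}(funrposBneg h).
Qed.

(** Real and imaginary parts are treated separately, each of them through its
    positive and negative parts and increasing limits of simple functions. *)
Lemma trig_approx_L2 f : cmeasurable f -> (energy f < +oo)%E -> trig_approx f.
Proof.
move=> mf foo; have [m1 m2] := mf.
have part (k : borel (circle R) -> R) : measurable_fun setT k ->
    (forall z, `|k z| <= normc (f z)) -> trig_approx (fun z => (k z)%:C).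
  move=> mk kf; apply: trig_approx_real => //; apply: le_lt_trans foo.
  apply: ge0_le_integral => //.
  - by move=> z _; rewrite lee_fin sqr_ge0.
  - by apply/measurable_EFinP; exact: measurable_funX.
  - exact: measurable_energy.
  move=> z _; rewrite lee_fin -[leLHS]real_normK ?num_real//.
  by rewrite lerXn2r ?nnegrE ?normc_ge0.
rewrite (_ : f = fun z => (Re (f z))%:C + 'i * (Im (f z))%:C); last first.
  by apply/funext => z; rewrite -complexE.
apply: trig_approxD; first by apply: part => // z; exact: normr_Re_le.
by apply: trig_approxZ; apply: part => // z; exact: normr_Im_le.
Qed.

Lemma trigL2_dense (v : L2 mu) (e : R) : 0 < e ->
  exists p, L2norm (v - trigL2 mu p) < e.
Proof.
move=> e0; have [mv _] := L2funP (repr v).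
have [_ /(_ _ (exprn_gt0 2 e0))[p vp]] := trig_approx_L2 mv (energy_lty (repr v)).
exists p; rewrite -(@ltr_pXn2r _ 2) ?nnegrE ?L2norm_ge0 ?(ltW e0)//.
rewrite -lte_fin; apply: le_lt_trans vp.
rewrite -[v in X in (X <= _)%E]L2_reprK.
rewrite (_ : \pi_(L2 mu) (repr v) - trigL2 mu p =
    \pi_(L2 mu) (repr v - Sub (evc p) (evc_square_integrable mu p))).
  by rewrite energy_L2norm.
by rewrite /trigL2 piE.
Qed.

End density.

(** * Density in the weak topology *)

Section weak_density.
Variables (R : realType) (B : normedModType R[i]).

Lemma normr_normc (z : R[i]) : `|z| = (normc z)%:C.
Proof. by []. Qed.

(** The sets of points that are close to [f] on finitely many functionals form
    the base of a filter, which converges to [f] in the product topology because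
    it does so coordinatewise; hence every weak neighbourhood of [f] contains one
    of these sets. *)
Lemma weak_denseP (S : set B) :
  (forall (f : B) (Phi : seq (dual B)) (e : R), 0 < e ->
     exists2 y, S y & forall phi, phi \in Phi ->
       normc (sval phi y - sval phi f) < e) ->
  dense (S : set (weak B)).
Proof.
move=> approx U [f Uf] [W oW WU].
pose D : set (seq (dual B) * R) := [set i | 0 < i.2].
pose V (i : seq (dual B) * R) : set {ptws dual B -> R[i]} :=
  [set g | exists2 y, S y & g = weak_eval y /\
     forall phi, phi \in i.1 -> normc (sval phi y - sval phi f) < i.2].
pose F := filter_from D V.
have FF : Filter F.
  apply: filter_from_filter; first by exists ([::], 1); exact: ltr01.
  move=> i j i0 j0; exists (i.1 ++ j.1, Num.min i.2 j.2).
    by rewrite /D /= lt_min i0.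
  move=> g [y Sy [gy gV]]; split; exists y => //; split=> // phi phiP.
    have := gV phi; rewrite mem_cat phiP => /(_ isT) /lt_le_trans; apply.
    by rewrite ge_min lexx.
  have := gV phi; rewrite mem_cat phiP orbT => /(_ isT) /lt_le_trans; apply.
  by rewrite ge_min lexx orbT.
have Fcvg : F --> (weak_eval f : {ptws dual B -> R[i]}).
  apply/cvg_sup => phi A [X [[Y oY <-] Yf] XA].
  have : nbhs (sval phi f : R[i]^o) Y by exact: open_nbhs_nbhs.
  move=> /nbhs_ballP[e /= e0 eY].
  have eE : e = (Re e)%:C by rewrite RRe_real// gtr0_real.
  have {}e0 : 0 < Re e by rewrite -ltcR -eE.
  exists ([:: phi], Re e) => // g [y Sy [-> gV]]; apply: XA; apply: eY.
  rewrite -ball_normE /= eE -normrN opprB ltcR.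
  by apply: gV; rewrite mem_head.
have [i i0 iW] : F W.
  by apply: Fcvg; apply: open_nbhs_nbhs; split => //; move: Uf; rewrite -WU.
have [y Sy yf] := approx f i.1 i.2 i0.
exists y; split => //; rewrite -WU; apply: iW; exists y => //.
Qed.

End weak_density.

Section dual_bound.
Variable R : realType.
Variable mu : probability (borel (circle R)) R.

Lemma dual_bounded (phi : dual (L2 mu)) :
  exists2 K : R, 0 <= K & forall v, normc (sval phi v) <= K * L2norm v.
Proof.
have [k [kr kP]] : exists k : R[i], k \is Num.real /\ forall x, k < x ->
    forall y, `|sval phi y| <= x * `|y|.
  by apply/linear_boundedP; apply: continuous_linear_bounded; exact: (svalP phi).
exists (`|Re k| + 1); first by rewrite addr_ge0.
move=> v; rewrite -lecR rmorphM; apply: kP.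
rewrite -(RRe_real kr) ltcR (le_lt_trans (ler_norm _))// ltrDl//.
Qed.

Lemma dual_bounded_seq (Phi : seq (dual (L2 mu))) :
  exists2 K : R, 0 <= K & forall phi, phi \in Phi ->
    forall v, normc (sval phi v) <= K * L2norm v.
Proof.
elim: Phi => [|phi Phi [K K0 KP]]; first by exists 0.
have [M M0 MP] := dual_bounded phi.
exists (K + M); first exact: addr_ge0.
move=> psi; rewrite inE => /orP[/eqP ->|/KP h] v.
  by apply: le_trans (MP v) _; rewrite ler_wpM2r ?L2norm_ge0// lerDr.
by apply: le_trans (h v) _; rewrite ler_wpM2r ?L2norm_ge0// lerDl.
Qed.

End dual_bound.

(** * Enumeration of the polynomials to be approximated *)

Section schedule.
Variable R : realType.

Definition rational_trig (w : seq (rat * rat * int)) : seq (R[i] * int) :=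
  [seq (ratr x.1.1 +i* ratr x.1.2, x.2) | x <- w].

(** An enumeration of the polynomials with rational coefficients and l1-norm at
    most 1, the zero polynomial filling the gaps. *)
Definition nth_goal n : seq (R[i] * int) :=
  if unpickle n is Some w then if l1norm (rational_trig w) <= 1 then rational_trig w else [::]
  else [::].

(** The indices k of stage s form the block 2^s - 1 <= k < 2^(s+1) - 1.  In a
    block the polynomial to be approximated and the weight are constant, and the
    2-adic valuation makes every polynomial come back in infinitely many
    stages. *)
Definition stage k := trunc_log 2 k.+1.
Definition riesz_goal k := nth_goal (logn 2 (stage k).+1).
Definition riesz_weight k : R[i] := (stage k + 2)%:R^-1.

Lemma l1_nth_goal n : l1norm (nth_goal n) <= 1.
Proof.
have l0 : l1norm ([::] : seq (R[i] * int)) <= 1 by rewrite /l1norm big_nil ler01.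
by rewrite /nth_goal; case: unpickle => [w|//]; case: ifP.
Qed.

Lemma l1_riesz_goal k : l1norm (riesz_goal k) <= 1.
Proof. exact: l1_nth_goal. Qed.

Lemma weight_ge0 k : 0 <= riesz_weight k.
Proof. by rewrite invr_ge0. Qed.

Lemma weight_le2 k : riesz_weight k <= 2^-1.
Proof. by rewrite lef_pV2 ?posrE ?ltr0n ?addn2// ler_nat. Qed.

Lemma weight_decr k : riesz_weight k.+1 <= riesz_weight k.
Proof.
rewrite lef_pV2 ?posrE ?ltr0n ?addn2// ler_nat !ltnS.
by apply: leq_trunc_log.
Qed.

Lemma stage_block s i : (i < 2 ^ s)%N -> stage (2 ^ s - 1 + i) = s.
Proof.
move=> i_s; apply: trunc_log_eq => //.
by rewrite expnS; have := expn_gt0 2 s; lia.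
Qed.

Lemma stage_goal (w : seq (rat * rat * int)) s0 : l1norm (rational_trig w) <= 1 ->
  exists2 s, (s0 <= s)%N & nth_goal (logn 2 s.+1) = rational_trig w.
Proof.
move=> w1; pose a := pickle w.
(* The 2-adic valuation of s + 1 is a and s is at least s0. *)
exists (2 ^ a * (2 * s0 + 1)).-1.
  by have := expn_gt0 2 a; have := leq_pmull (2 * s0 + 1) (expn_gt0 2 a); lia.
rewrite prednK; last by rewrite muln_gt0 expn_gt0 addn1.
rewrite lognM ?expn_gt0 ?addn1// pfactorK// (@logn_coprime 2) ?coprime2n ?mul2n/= ?odd_double// addn0.
by rewrite /nth_goal pickleK w1.
Qed.

(** Block length times squared weight, 2^s / (s + 2)^2, is at least
    (s + 2) / 64. *)
Lemma cube_le_exp2 s : ((s + 2) ^ 3 <= 64 * 2 ^ s)%N.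
Proof.
case: s => [//|[//|s]]; elim: s => [//|s ih].
rewrite [X in (_ <= 64 * X)%N]expnS; move: (2 ^ s.+2)%N ih => x.
by rewrite !expnS !expn0; nia.
Qed.

End schedule.

Section rational.
Variables (R : realType) (mu : probability (borel (circle R)) R).

Lemma rational_approx (p : seq (R[i] * int)) (e : R) : 0 < e ->
  exists w, L2norm (trigL2 mu p - trigL2 mu (rational_trig R w)) < e.
Proof.
elim: p e => [|x p ih] e e0.
  by exists [::]; rewrite subrr; have := L2normZ 0 (0 : L2 mu); rewrite scale0r normc0 mul0r => ->.
have e2 : 0 < e / 2 by rewrite divr_gt0.
have e4 : 0 < e / 4 by rewrite divr_gt0.
have [w wp] := ih _ e2.
have [a ax] := rat_close (Re x.1) e4; have [b bx] := rat_close (Im x.1) e4.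
pose x' : R[i] := ratr a +i* ratr b.
exists ((a, b, x.2) :: w).
have xx : L2norm (trigL2 mu [:: (x.1 - x', x.2)]) <= e / 2.
  apply: trigL2_norm_le; rewrite /l1norm big_seq1/= normr_normc lecR.
  apply: le_trans (normc_le_ReIm _) _; rewrite Defs.ReD Defs.ImD /=; lra.
have -> : trigL2 mu (x :: p) - trigL2 mu (rational_trig R ((a, b, x.2) :: w)) =
   trigL2 mu [:: (x.1 - x', x.2)] + (trigL2 mu p - trigL2 mu (rational_trig R w)).
  rewrite -[x :: p]cat1s -[rational_trig R (_ :: _)]/([:: (x', x.2)] ++ rational_trig R w) !trigL2_cat.
  rewrite opprD addrACA; congr (_ + _); apply/eqP; rewrite subr_eq; apply/eqP.
  rewrite -trigL2_cat; apply: trigL2_eq => z; rewrite evc_cat /evc !ev_seq1.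
  by rewrite -mulrDl subrK; case: (x) => u v; rewrite ev_seq1.
apply: le_lt_trans (ler_L2normD _ _) _; lra.
Qed.

End rational.

(** * Weak supercyclicity *)

Section main.
Variables (R : realType) (mu : probability (borel (circle R)) R).
Local Notation f := (riesz_goal R).
Local Notation c := (riesz_weight R).
Hypothesis mu_coef : forall m, fourier mu m = riesz_coef f c m.

Let u := innovation f c.

(** Within the block of stage s the innovations are orthogonal, with norms at
    most 2. *)
Lemma innovation_bessel (phi : dual (L2 mu)) (K : R) s : 0 <= K ->
  (forall v, normc (sval phi v) <= K * L2norm v) ->
  \sum_(i < 2 ^ s) normc (sval phi (trigL2 mu (u (2 ^ s - 1 + i)))) ^+ 2 <= 4 * K ^+ 2.
Proof.
move=> K0 phiK.
rewrite (_ : 4 * K ^+ 2 = (K * 2) ^+ 2); last by ring.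
apply: (bessel (u := fun i => u (2 ^ s - 1 + i)%N) K0 phiK) => [i j ij _|i _].
  have -> : fourier mu = riesz_coef f c by apply/funext.
  by apply: innovation_orth => y; apply: deg_innovation; rewrite ltn_add2l.
apply: trigL2_norm_le; rewrite rmorph_nat.
by apply: l1_innovation; [exact: l1_riesz_goal|exact: weight_ge0|exact: weight_le2].
Qed.

(** Summing [innovation_bessel] over the functionals, the mean over the block of
    stage s of the sum of |phi u_k|^2 is O (2^(-s)), which for large s is below
    delta^2 times the squared weight; some k does at least as well as the
    mean. *)
Lemma exists_small_innovation (Phi : seq (dual (L2 mu))) (K delta : R) (w : seq (rat * rat * int)) :
  0 <= K -> (forall phi, phi \in Phi -> forall v, normc (sval phi v) <= K * L2norm v) ->
  l1norm (rational_trig R w) <= 1 -> 0 < delta ->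
  exists2 k, f k = rational_trig R w & forall phi, phi \in Phi ->
    normc (sval phi (trigL2 mu (u k))) <= delta / (stage k + 2)%:R.
Proof.
move=> K0 PhiK w1 delta0.
pose A := (size Phi)%:R * (256 * K ^+ 2) : R.
have A0 : 0 <= A.
  exact: mulr_ge0 (ler0n _ _) (mulr_ge0 (ler0n _ _) (sqr_ge0 K)).
have [s sA ts] := stage_goal (Num.bound (A / delta ^+ 2)) w1.
have block_sum : \sum_(i < 2 ^ s) \sum_(phi <- Phi)
    normc (sval phi (trigL2 mu (u (2 ^ s - 1 + i)))) ^+ 2 <= (size Phi)%:R * (4 * K ^+ 2).
  rewrite exchange_big /= -sum1_size natr_sum mulr_suml big_seq [leRHS]big_seq.
  by apply: ler_sum => phi phiP; rewrite mul1r; apply: innovation_bessel => //; exact: PhiK.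
have [i iP] : exists i : 'I_(2 ^ s), \sum_(phi <- Phi)
    normc (sval phi (trigL2 mu (u (2 ^ s - 1 + i)))) ^+ 2 <= (delta / (s + 2)%:R) ^+ 2.
  apply: contrapT => /forallNP H; move: block_sum; apply/negP; rewrite -ltNge.
  apply: (@lt_le_trans _ _ (\sum_(i < 2 ^ s) (delta / (s + 2)%:R) ^+ 2)); last first.
    by apply: ler_sum => i _; have /negP := H i; rewrite -ltNge => /ltW.
  have d2 : 0 < delta ^+ 2 by rewrite exprn_gt0.
  have s2 : 0 < (s + 2)%:R :> R by rewrite ltr0n addn2.
  have A_s : A < delta ^+ 2 * (s + 2)%:R.
    rewrite mulrC -ltr_pdivrMr//.
    apply: (lt_le_trans (archi_boundP _)); first by rewrite divr_ge0// ltW.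
    by rewrite ler_nat (leq_trans sA)// leq_addr.
  have := cube_le_exp2 s; rewrite -(ler_nat R) natrX natrM => cube.
  rewrite sumr_const card_ord -[ltRHS]mulr_natr exprMn exprVn [ltRHS]mulrAC ltr_pdivlMr ?exprn_gt0//.
  have : A * (s + 2)%:R ^+ 2 < delta ^+ 2 * (s + 2)%:R * (s + 2)%:R ^+ 2.
    by rewrite ltr_pM2r ?exprn_gt0.
  rewrite -mulrA -exprS => /lt_le_trans /(_ (ler_wpM2l (ltW d2) cube)).
  rewrite /A => h; rewrite -(@ltr_pM2l _ 64)//.
  apply: le_lt_trans (_ : _ <= (size Phi)%:R * (256 * K ^+ 2) * (s + 2)%:R ^+ 2) _.
    by rewrite le_eqVlt; apply/orP; left; apply/eqP; ring.
  by rewrite [ltRHS]mulrCA.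
have k_s := stage_block (ltn_ord i).
exists (2 ^ s - 1 + i)%N; first by rewrite /f k_s.
move=> phi phiP; rewrite k_s.
rewrite -(@ler_pXn2r _ 2) ?nnegrE ?normc_ge0 ?divr_ge0 ?(ltW delta0)//.
apply: le_trans iP; rewrite (big_rem phi)//= lerDl.
by apply: sumr_ge0 => psi _; rewrite sqr_ge0.
Qed.

(** Approximate [v] by a polynomial with rational coefficients and divide it by
    an integer M to bring its l1-norm below 1; the result is c_k^-1 z^(n_k) minus
    c_k^-1 times an innovation on which the functionals are small, and
    multiplying back by M costs a constant factor only. *)
Lemma orbit_approx (v : L2 mu) (Phi : seq (dual (L2 mu))) (e : R) : 0 < e ->
  exists2 y, projective_orbit (mulz mu) (trigL2 mu [:: (1, 0)]) y &
    forall phi, phi \in Phi -> normc (sval phi y - sval phi v) < e.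
Proof.
move=> e0; have e34 : e / 4 + e / 4 + e / 4 < e by lra.
have [K K0 PhiK] := dual_bounded_seq Phi.
have K1 : 0 < K + 1 by rewrite ltr_wpDl.
have eK : 0 < e / 4 / (K + 1) by rewrite !divr_gt0.
have [p pv] := trigL2_dense v eK.
have [w wp] := rational_approx mu p eK.
pose M := (Num.bound (\sum_(x <- rational_trig R w) normc x.1)).+1.
have M0 : 0 < M%:R :> R by rewrite ltr0n.
pose w' : seq (rat * rat * int) := [seq (x.1.1 / M%:R, x.1.2 / M%:R, x.2) | x <- w].
have MC : M%:R = (M%:R : R)%:C :> R[i] by rewrite rmorph_nat.
have embed_w' : rational_trig R w' = tscale (M%:R^-1) (rational_trig R w).
  rewrite /rational_trig /tscale /w' -!map_comp; apply: eq_map => -[[x y] m] /=.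
  rewrite MC -fmorphV; congr (_, _); apply/eqP; rewrite eq_complex /= !mul0r subr0 addr0.
  by rewrite !rmorphM !fmorphV !rmorph_nat; apply/andP; split; apply/eqP; exact: mulrC.
have w'1 : l1norm (rational_trig R w') <= 1.
  rewrite embed_w' l1_scale normfV normr_nat mulrC ler_pdivrMr ?ltr0n// mul1r.
  rewrite (_ : l1norm _ = (\sum_(x <- rational_trig R w) normc x.1)%:C); last by rewrite rmorph_sum.
  rewrite MC lecR; have S0 : 0 <= \sum_(x <- rational_trig R w) normc x.1.
    by apply: sumr_ge0 => x _; exact: normc_ge0.
  by apply/ltW/(lt_trans (archi_boundP S0)); rewrite ltr_nat.
have delta0 : 0 < e / (4 * M%:R) by rewrite divr_gt0// mulr_gt0.
have [k fk kP] := exists_small_innovation K0 PhiK w'1 delta0.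
have s0 : 0 < (stage k + 2)%:R :> R by rewrite ltr0n addn2.
(* This is M / c_k. *)
pose ar : R := (stage k + 2)%:R * M%:R.
have ar0 : 0 < ar by rewrite mulr_gt0.
exists (ar%:C *: trigL2 mu [:: (1, (freq f k)%:Z)]).
  by exists ar%:C, (freq f k); rewrite iter_mulz.
move=> phi phiP.
have uk : trigL2 mu (u k) = trigL2 mu [:: (1, (freq f k)%:Z)] - (ar%:C)^-1 *: trigL2 mu (rational_trig R w).
  rewrite /u /innovation -cat1s trigL2_cat trigL2_scale fk embed_w' trigL2_scale.
  rewrite scaleNr scalerA /c /riesz_weight /ar rmorphM/= invfM !rmorph_nat.
  by [].
have E : sval phi (ar%:C *: trigL2 mu [:: (1, (freq f k)%:Z)]) - sval phi v =
   ar%:C * sval phi (trigL2 mu (u k)) - sval phi (trigL2 mu p - trigL2 mu (rational_trig R w))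
    - sval phi (v - trigL2 mu p).
  have arC : ar%:C != 0 by rewrite fmorph_eq0 gt_eqF.
  rewrite uk !linearB !linearZ/=.
  move: (sval phi (trigL2 mu (rational_trig R w))) (sval phi (trigL2 mu p)) (sval phi v)
    (sval phi (trigL2 mu _)) (ar%:C) arC => E P V Z A A0.
  rewrite -[LHS]/(A * Z - V).
  by rewrite -[X in _ * (_ + X)]/(A^-1 * - E); field; exact: A0.
have h1 : normc (ar%:C * sval phi (trigL2 mu (u k))) <= e / 4.
  rewrite normcM normc_real gtr0_norm//.
  apply: le_trans (ler_wpM2l (ltW ar0) (kP _ phiP)) _.
  rewrite le_eqVlt; apply/orP; left; apply/eqP; rewrite /ar.
  by field; rewrite !lt0r_neq0.
have eKe : K * (e / 4 / (K + 1)) <= e / 4.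
  rewrite mulrCA ler_piMr ?divr_ge0 ?(ltW e0)// ler_pdivrMr// mul1r lerDl//.
have h2 : normc (sval phi (trigL2 mu p - trigL2 mu (rational_trig R w))) <= e / 4.
  apply: le_trans (PhiK _ phiP _) _; apply: le_trans eKe.
  by rewrite ler_wpM2l// ltW.
have h3 : normc (sval phi (v - trigL2 mu p)) <= e / 4.
  apply: le_trans (PhiK _ phiP _) _; apply: le_trans eKe.
  by rewrite ler_wpM2l// ltW.
rewrite E; apply: le_lt_trans (le_normcD _ _) _; rewrite normcN.
apply: le_lt_trans e34; apply: lerD h3; apply: le_trans (le_normcD _ _) _; rewrite normcN.
exact: lerD.
Qed.

Lemma weakly_supercyclic_mulz : weakly_supercyclic (mulz mu).
Proof.
split; first exact: mulz_continuous.
exists (trigL2 mu [:: (1, 0)]); apply: weak_denseP => v Phi e e0.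
by have [y oy yP] := orbit_approx v Phi e0; exists y.
Qed.

Lemma fourier_vanishes (e : R) : 0 < e ->
  exists N : nat, forall n : int, (N <= `|n|)%N -> `|fourier mu n| < e%:C.
Proof.
move=> e0; pose s := Num.bound e^-1; pose k := (2 ^ s - 1 + 0)%N.
exists (freq_bound f k).+1 => n kn.
rewrite mu_coef; apply: le_lt_trans (riesz_coef_decay _ _ _ _ kn) _.
- exact: l1_riesz_goal.
- exact: weight_ge0.
- exact: weight_le2.
- exact: weight_decr.
rewrite /riesz_weight stage_block ?expn_gt0//.
rewrite -(rmorph_nat (real_complex R)) -fmorphV ltcR invf_plt ?posrE ?ltr0n ?addn2//.
apply: lt_trans (archi_boundP _) _; first by rewrite invr_ge0 ltW.
by rewrite ltr_nat -/s; lia.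
Qed.

End main.

Theorem theorem1p2 (R : realType) :
  exists mu : probability (borel (circle R)) R,
    (forall e : R, 0 < e -> exists N : nat, forall n : int,
       (N <= `|n|)%N -> `|fourier mu n| < e%:C) /\
    weakly_supercyclic (mulz mu).
Proof.
have l1g := l1_riesz_goal R; have w0 := weight_ge0 R; have w2 := weight_le2 R.
have [mu muE] := @limit_measure_exists R (riesz (riesz_goal R) (riesz_weight R))
  (fun k => increment (riesz_goal R) (riesz_weight R) (riesz (riesz_goal R) (riesz_weight R) k) k)
  erefl (fun k => erefl)
  (fun k t => riesz_ge0 l1g w0 w2 k (norm_cis t))
  (l1_increment_le l1g w0 w2) (@freq_increment _ _ _).
have mu_coef m : fourier mu m = riesz_coef (riesz_goal R) (riesz_weight R) m.
  by apply: (muE m _ `|m|%N) => k; exact: riesz_coef_lim.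
exists mu; split; first exact: fourier_vanishes.
exact: weakly_supercyclic_mulz.
Qed.
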